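(* There is an algorithm that, given a finite nonempty set $S\subset\mathbb{R}^3_{>0}$ of $n=|S|$ points with rational coordinates, computes $R_2(S)$ exactly by constructing a planar subdivision of $\Delta_2$ into polygonal cells such that on each cell the active point and the active objective coordinate of the lower Tchebycheff envelope are fixed (i.e. for each cell there are $p\in S$ and $i\in\{1,2,3\}$ with $\tau_S(w)=w_ip_i$ for all $w$ in the cell). The procedure is polynomial in $|S|$, with worst-case running time $O(n^6)$.
   Context: Let $\Delta_2=\{w\in\mathbb{R}^3_{\ge 0}:w_1+w_2+w_3=1\}$, with $\mathrm{d}w$ two-dimensional (unnormalized) Lebesgue measure on $\Delta_2$ in the coordinates $(w_1,w_2)$, so that $\Delta_2$ has total measure $1/2$. For $p\in\mathbb{R}^3_{>0}$ and $w\in\Delta_2$ let $g_p(w)=\max\{w_1p_1,w_2p_2,w_3p_3\}$. For a finite nonempty set $S\subset\mathbb{R}^3_{>0}$ let $\tau_S(w)=\min_{p\in S}g_p(w)$ and $R_2(S)=\int_{\Delta_2}\tau_S(w)\,\mathrm{d}w$. Running time counts arithmetic operations and comparisons on rational numbers at unit cost. *)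

(* Defs.v *)
From HB Require Import structures.
From mathcomp Require Import all_boot all_order all_algebra.
From mathcomp Require Import all_classical all_reals all_analysis.

Set Implicit Arguments.
Unset Strict Implicit.
Unset Printing Implicit Defensive.

Import Order.TTheory GRing.Theory Num.Theory.
Import numFieldNormedType.Exports.

Local Open Scope classical_set_scope.
Local Open Scope ring_scope.

Section Envelope.
Variable R : realType.

Definition Delta2 : set 'rV[R]_3 :=
  [set w | (forall i, 0 <= w 0 i) /\ \sum_(i < 3) w 0 i = 1].

(* The plane w_1 + w_2 + w_3 = 1 in the coordinates (w_1, w_2). *)
Definition chart (x : R * R) : 'rV[R]_3 :=
  \row_(i < 3) [:: x.1; x.2; 1 - x.1 - x.2]`_i.

Definition cheby (p w : 'rV[R]_3) : R :=
  \big[Num.max/w 0 0 * p 0 0]_(i < 3) (w 0 i * p 0 i).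

(* A finite set of points is presented by a list; for S = [::] this is the
   junk value cheby 0 w. *)
Definition tau (S : seq 'rV[R]_3) (w : 'rV[R]_3) : R :=
  \big[Num.min/cheby (head 0 S) w]_(p <- S) cheby p w.

Definition R2 (S : seq 'rV[R]_3) : \bar R :=
  (\int[lebesgue_measure \x lebesgue_measure]_(x in chart @^-1` Delta2)
     (tau S (chart x))%:E)%E.

End Envelope.

Section Polygons.
Variable R : realType.
Implicit Types (u v x : R * R) (vs : seq (R * R)).

(* Twice the signed area of the triangle u v x: positive iff x lies strictly
   to the left of the line from u to v. *)
Definition orient u v x : R :=
  (v.1 - u.1) * (x.2 - u.2) - (v.2 - u.2) * (x.1 - u.1).

Definition edges vs : seq ((R * R) * (R * R)) := zip vs (rot 1 vs).

(* vs lists the vertices of a nondegenerate convex polygon counterclockwise: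
   every other vertex is strictly to the left of each directed edge. *)
Definition convex_polygon vs : Prop :=
  [/\ (3 <= size vs)%N, uniq vs
    & forall e, e \in edges vs ->
      forall x, x \in vs -> x != e.1 -> x != e.2 -> 0 < orient e.1 e.2 x].

Definition polygon_region vs : set (R * R) :=
  [set x | forall e, e \in edges vs -> 0 <= orient e.1 e.2 x].

Definition planar_subdivision (D : set (R * R)) (Ps : seq (seq (R * R))) :=
  [/\ forall vs, vs \in Ps -> convex_polygon vs,
      \bigcup_(vs in [set` Ps]) polygon_region vs = D
    & forall j k, (j < k < size Ps)%N ->
      interior (polygon_region (nth [::] Ps j)) `&`
      interior (polygon_region (nth [::] Ps k)) = set0].

End Polygons.

(* A random access machine over the rationals: rational registers [rreg],
   natural-number registers [ireg] (used for counting and addressing), a memory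
   [ram] of rationals and an append-only output tape [out].  Every instruction
   and every test of a condition costs one step.  Division is total, with
   x / 0 = 0. *)
Inductive arith := OpAdd | OpSub | OpMul | OpDiv.

Definition arith_sem (o : arith) (x y : rat) : rat :=
  match o with
  | OpAdd => x + y | OpSub => x - y | OpMul => x * y | OpDiv => x / y
  end.

Inductive instr :=
| RConst of nat & rat           (* r_d := q *)
| ROp of arith & nat & nat & nat (* r_d := r_a o r_b *)
| RLoad of nat & nat            (* r_d := ram[i_a] *)
| RStore of nat & nat           (* ram[i_a] := r_b *)
| IConst of nat & nat           (* i_d := k *)
| IAdd of nat & nat & nat       (* i_d := i_a + i_b *)
| ISub of nat & nat & nat       (* i_d := i_a - i_b, truncated at 0 *)
| ROut of nat.                  (* append r_a to the output *)

Inductive cond :=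
| RLe of nat & nat | RLt of nat & nat | REq of nat & nat
| ILe of nat & nat | ILt of nat & nat | IEq of nat & nat.

Inductive cmd :=
| Skip
| Instr of instr
| Seq of cmd & cmd
| If of cond & cmd & cmd
| While of cond & cmd.

Record state := State {
  rreg : nat -> rat;
  ireg : nat -> nat;
  ram : nat -> rat;
  out : seq rat }.

Definition upd (T : Type) (f : nat -> T) (k : nat) (v : T) : nat -> T :=
  fun j => if j == k then v else f j.

Definition set_rreg st d v := State (upd (rreg st) d v) (ireg st) (ram st) (out st).
Definition set_ireg st d v := State (rreg st) (upd (ireg st) d v) (ram st) (out st).
Definition set_ram st a v := State (rreg st) (ireg st) (upd (ram st) a v) (out st).

Definition instr_sem (c : instr) (st : state) : state :=
  match c with
  | RConst d q => set_rreg st d q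
  | ROp o d a b => set_rreg st d (arith_sem o (rreg st a) (rreg st b))
  | RLoad d a => set_rreg st d (ram st (ireg st a))
  | RStore a b => set_ram st (ireg st a) (rreg st b)
  | IConst d k => set_ireg st d k
  | IAdd d a b => set_ireg st d (ireg st a + ireg st b)%N
  | ISub d a b => set_ireg st d (ireg st a - ireg st b)%N
  | ROut a => State (rreg st) (ireg st) (ram st) (rcons (out st) (rreg st a))
  end.

Definition cond_sem (b : cond) (st : state) : bool :=
  match b with
  | RLe x y => rreg st x <= rreg st y
  | RLt x y => rreg st x < rreg st y
  | REq x y => rreg st x == rreg st y
  | ILe x y => (ireg st x <= ireg st y)%N
  | ILt x y => (ireg st x < ireg st y)%N
  | IEq x y => ireg st x == ireg st y
  end.

(* exec c st t st': from st, the command c halts in state st' after exactly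
   t steps. *)
Inductive exec : cmd -> state -> nat -> state -> Prop :=
| ESkip st : exec Skip st 0 st
| EInstr i st : exec (Instr i) st 1 (instr_sem i st)
| ESeq c1 c2 st1 st2 st3 t1 t2 :
    exec c1 st1 t1 st2 -> exec c2 st2 t2 st3 ->
    exec (Seq c1 c2) st1 (t1 + t2) st3
| EIfT b c1 c2 st t st' :
    cond_sem b st -> exec c1 st t st' -> exec (If b c1 c2) st t.+1 st'
| EIfF b c1 c2 st t st' :
    ~~ cond_sem b st -> exec c2 st t st' -> exec (If b c1 c2) st t.+1 st'
| EWhileT b c st1 st2 st3 t1 t2 :
    cond_sem b st1 -> exec c st1 t1 st2 -> exec (While b c) st2 t2 st3 ->
    exec (While b c) st1 (t1 + t2).+1 st3
| EWhileF b c st :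
    ~~ cond_sem b st -> exec (While b c) st 1 st.

Lemma exec_det c st t1 st1 t2 st2 :
  exec c st t1 st1 -> exec c st t2 st2 -> t1 = t2 /\ st1 = st2.
Proof.
move=> H; elim: H t2 st2 => {c st t1 st1}
  [st|i st|c1 c2 sa sb sc ta tb _ IH1 _ IH2|b c1 c2 sa ta sb B _ IH
  |b c1 c2 sa ta sb B _ IH|b c sa sb sc ta tb B _ IH1 _ IH2|b c sa B] t2 st2 H;
  inversion H; subst => //;
  repeat match goal with
  | B1 : is_true (cond_sem ?b ?s), B2 : is_true (~~ cond_sem ?b ?s) |- _ =>
      by rewrite B1 in B2
  | IH : forall t s, exec ?c ?x t s -> _, E : exec ?c ?x _ _ |- _ =>
      case: (IH _ _ E) => ? ?; subst; clear E
  end; by [].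
Qed.

(* The points are stored contiguously from address 0, three coordinates each;
   their number is in i_0, and everything else is zero. *)
Definition input (s : seq 'rV[rat]_3) : state :=
  State (fun _ => 0) (upd (fun _ => 0%N) 0 (size s))
    (fun k => (nth 0 s (k %/ 3)) 0 (inord (k %% 3))) [::].

(* A cell with its active point, active coordinate, and vertices in the
   coordinates (w_1, w_2). *)
Definition cell := ('rV[rat]_3 * 'I_3 * seq (rat * rat))%type.
Definition cell_point (c : cell) := c.1.1.
Definition cell_coord (c : cell) := c.1.2.
Definition cell_verts (c : cell) := c.2.

(* The vertex count makes the encoding self-delimiting, so that a list of cells
   can be recovered from the concatenation of their encodings. *)
Definition encode_cell (c : cell) : seq rat :=
  [seq cell_point c 0 i | i <- enum 'I_3] ++
  [:: (cell_coord c)%:R; (size (cell_verts c))%:R] ++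
  flatten [seq [:: v.1; v.2] | v <- cell_verts c].

Definition rat_vec (R : realType) (p : 'rV[rat]_3) : 'rV[R]_3 := map_mx ratr p.

Definition cell_polygon (R : realType) (c : cell) : seq (R * R) :=
  [seq (ratr v.1, ratr v.2) | v <- cell_verts c].

(* The value of R_2(S) is returned in r_0, the subdivision on the output
   tape. *)
Definition correct_output (R : realType) (s : seq 'rV[rat]_3) (st : state) :=
  let S := [seq rat_vec R p | p <- s] in
  (ratr (rreg st 0))%:E = R2 S /\
  exists cs : seq cell,
    [/\ out st = flatten [seq encode_cell c | c <- cs],
        planar_subdivision (@chart R @^-1` @Delta2 R)
          [seq cell_polygon R c | c <- cs]
      & forall c, c \in cs ->
          cell_point c \in s /\
          forall x, polygon_region (cell_polygon R c) x ->
            tau S (chart x) =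
              chart x 0 (cell_coord c) * rat_vec R (cell_point c) 0 (cell_coord c)].

(* Main.v *)
Require Import Defs.
From mathcomp Require Import all_boot all_order all_algebra.
From mathcomp Require Import all_classical all_reals all_analysis measurable_realfun.
From mathcomp Require Import ring lra zify.

(* Fix a coordinate i, put j = i + 1, k = i + 2 (mod 3), and use the projective
   coordinates u = w_j / w_i, v = w_k / w_i.  For a point p of S with a = p_i,
   the weights at which w_i p_i is the active value form the rectangle
   u <= a / p_j, v <= a / p_k minus the quadrants u < a / q_j, v < a / q_k of the
   points q that are lower than p in coordinate i (ties are broken by the order
   of the list).  The vertical lines u = a / q_j cut this staircase into at most
   n axis-parallel rectangles, which are quadrilaterals in Delta_2; the integral
   of w_i over [u1, u2] x [v1, v2] is the alternating sum over the four corners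
   of (1 + u + v)^-2 / 6.  Sweeping over i, p and the slabs takes O(n^3) steps.
   Off the finitely many lines w_c p_c = w_c' q_c' with c <> c', the first
   minimizer p, its active coordinate and the slab of a weight are unique; this
   gives disjointness and, as these lines are nowhere dense and null, covering
   and the value of the integral. *)

Set Implicit Arguments.
Unset Strict Implicit.
Unset Printing Implicit Defensive.

Import Order.TTheory GRing.Theory Num.Theory.
Import numFieldNormedType.Exports.
Local Open Scope ring_scope.

(** * Loop programs and their running time *)

(** The sweep is defined over an arbitrary [realFieldType] because it is needed twice: over [rat] it
    is what the machine computes, over [R] it is what the geometry speaks of. [ratr] carries one to
    the other, since every branch is decided by an order comparison. All loops of the programs are
    bounded by the number of points, so termination and cost are read off the syntax. Nothing is
    sorted and the memory is never written: each slab end is found by a fresh pass over all points.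
    Weights on the exceptional lines are not located in any cell directly; they are reached as
    limits, the finite union of closed cells being closed. *)

Inductive prog :=
| PSkip
| PInstr of instr
| PSeq of prog & prog
| PIf of cond & prog & prog
| PFor of nat & prog.

(* The integer register 0 holds the number of points and bounds every loop;
   register 1 is scratch space for the increment. *)
Fixpoint compile (p : prog) : cmd :=
  match p with
  | PSkip => Skip
  | PInstr x => Instr x
  | PSeq p1 p2 => Seq (compile p1) (compile p2)
  | PIf b p1 p2 => If b (compile p1) (compile p2)
  | PFor k p1 =>
      Seq (Instr (IConst k 0))
        (While (ILt k 0)
           (Seq (compile p1) (Seq (Instr (IConst 1 1)) (Instr (IAdd k k 1)))))
  end.

Definition incr k st := instr_sem (IAdd k k 1) (instr_sem (IConst 1 1) st).

(** The iteration count is read once, on entry. This agrees with the compiled [While] if the body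
    leaves register 0 and the counter alone, as [wf] demands. *)
Fixpoint run (p : prog) (st : state) : state :=
  match p with
  | PSkip => st
  | PInstr x => instr_sem x st
  | PSeq p1 p2 => run p2 (run p1 st)
  | PIf b p1 p2 => if cond_sem b st then run p1 st else run p2 st
  | PFor k p1 =>
      iter (ireg st 0) (fun st' => incr k (run p1 st')) (instr_sem (IConst k 0) st)
  end.

Inductive loc := LR of nat | LI of nat | LRam | LOut.

Definition agree (l : loc) (st st' : state) : Prop :=
  match l with
  | LR k => rreg st k = rreg st' k
  | LI k => ireg st k = ireg st' k
  | LRam => ram st = ram st'
  | LOut => out st = out st'
  end.

Definition misses (l : loc) (x : instr) : bool :=
  match l, x with
  | LR k, (RConst d _ | ROp _ d _ _ | RLoad d _) => k != d
  | LI k, (IConst d _ | IAdd d _ _ | ISub d _ _) => k != d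
  | LRam, RStore _ _ => false
  | LOut, ROut _ => false
  | _, _ => true
  end.

(** A conservative check on the syntax, so frame conditions of concrete programs are discharged by
    evaluation. *)
Fixpoint keeps (l : loc) (p : prog) : bool :=
  match p with
  | PSkip => true
  | PInstr x => misses l x
  | PSeq p1 p2 | PIf _ p1 p2 => keeps l p1 && keeps l p2
  | PFor k p1 => [&& misses l (IConst k 0), misses l (IConst 1 1) & keeps l p1]
  end.

Lemma agree_trans l st1 st2 st3 : agree l st1 st2 -> agree l st2 st3 -> agree l st1 st3.
Proof. by case: l => /= [k|k||] -> ->. Qed.

Lemma misses_instr l x st : misses l x -> agree l (instr_sem x st) st.
Proof.
by case: l => [k|k||]; case: x => //= > /negPf; rewrite /upd => ->.
Qed.

Lemma misses_incr l k st :
  misses l (IConst k 0) -> misses l (IConst 1 1) -> agree l (incr k st) st.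
Proof.
by move=> lk l1; apply: (@agree_trans _ _ (instr_sem (IConst 1 1) st)); apply: misses_instr.
Qed.

Lemma keeps_run l p st : keeps l p -> agree l (run p st) st.
Proof.
elim: p st => [|x|p1 IH1 p2 IH2|b p1 IH1 p2 IH2|k p IH] st /=.
- by case: l.
- exact: misses_instr.
- by move=> /andP[/IH1 H1 /IH2 H2]; apply: agree_trans (H2 _) (H1 _).
- by move=> /andP[/IH1 H1 /IH2 H2]; case: ifP.
- move=> /and3P[lk l1 /IH H]; elim: (ireg st 0) => [|r IHr].
    exact: (@misses_instr _ (IConst k 0)).
  by rewrite iterS; apply: agree_trans (misses_incr _ lk l1) (agree_trans (H _) IHr).
Qed.

Fixpoint wf (p : prog) : bool :=
  match p with
  | PSkip | PInstr _ => true
  | PSeq p1 p2 | PIf _ p1 p2 => wf p1 && wf p2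
  | PFor k p1 => [&& (1 < k)%N, keeps (LI 0) p1, keeps (LI k) p1 & wf p1]
  end.

Fixpoint depth (p : prog) : nat :=
  match p with
  | PSkip | PInstr _ => 0
  | PSeq p1 p2 | PIf _ p1 p2 => maxn (depth p1) (depth p2)
  | PFor _ p1 => (depth p1).+1
  end.

Lemma leq_poly C1 C2 d1 d2 n t1 t2 : (0 < n)%N ->
  (t1 <= C1 * n ^ d1)%N -> (t2 <= C2 * n ^ d2)%N ->
  (t1 + t2 <= (C1 + C2) * n ^ maxn d1 d2)%N.
Proof.
move=> n0 h1 h2; rewrite mulnDl leq_add //.
  by apply: leq_trans h1 _; rewrite leq_mul2l leq_pexp2l ?leq_maxl ?orbT.
by apply: leq_trans h2 _; rewrite leq_mul2l leq_pexp2l ?leq_maxr ?orbT.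
Qed.

(** The constant precedes the state: it depends on the program alone and serves inputs of every
    size. A loop contributes one factor [ireg st 0], whence the exponent [depth]. *)
Lemma exec_compile p : wf p -> keeps (LI 0) p ->
  exists C, forall st, (0 < ireg st 0)%N ->
    exists t, exec (compile p) st t (run p st) /\ (t <= C * ireg st 0 ^ depth p)%N.
Proof.
elim: p => [|x|p1 IH1 p2 IH2|b p1 IH1 p2 IH2|k p IH] /=.
- by exists 0%N => st _; exists 0%N; split=> //; constructor.
- by exists 1%N => st _; exists 1%N; split=> //; constructor.
- move=> /andP[w1 w2] /andP[k1 k2].
  have [C1 H1] := IH1 w1 k1; have [C2 H2] := IH2 w2 k2; exists (C1 + C2)%N => st n0.
  have /= E := keeps_run st k1.
  have [t1 [e1 b1]] := H1 _ n0; have [|t2 [e2 b2]] := H2 (run p1 st); first by rewrite E.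
  exists (t1 + t2)%N; split; first exact: ESeq e1 e2.
  by apply: leq_poly => //; rewrite -E.
- move=> /andP[w1 w2] /andP[k1 k2].
  have [C1 H1] := IH1 w1 k1; have [C2 H2] := IH2 w2 k2; exists (C1 + C2).+1 => st n0.
  have [t1 [e1 b1]] := H1 _ n0; have [t2 [e2 b2]] := H2 _ n0.
  have := leq_poly n0 b1 b2; set N := (_ ^ _)%N => b12.
  have N0 : (0 < N)%N by rewrite expn_gt0 n0.
  case: ifPn => B.
    by exists t1.+1; split; [exact: EIfT|nia].
  by exists t2.+1; split; [exact: EIfF|nia].
- move=> /and4P[k1 kp0 kpk wp] /andP[k0 _].
  (* Each round costs the body plus three steps, for the test and the increment; the initialisation
     and the last test cost two more. As [n ^ depth p] is at least 1, [5 * n * n ^ depth p] absorbs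
     them. *)
  have [C H] := IH wp kp0; exists (C + 5)%N => st n0; set n := ireg st 0 in n0 *.
  set body := Seq (compile p) _; pose F st' := incr k (run p st').
  have loop r st1 : ireg st1 0 = n -> (ireg st1 k + r = n)%N ->
      exists t, exec (While (ILt k 0) body) st1 t (iter r F st1)
        /\ (t <= r * (C * n ^ depth p + 3) + 1)%N.
    elim: r st1 => [|r IHr] st1 E0 Ek.
      by exists 1%N; split=> //=; apply: EWhileF; rewrite /= E0 -Ek addn0 ltnn.
    have [|t [e b]] := H st1; first by rewrite E0.
    have Fk : ireg (F st1) k = (ireg st1 k).+1.
      by rewrite /F/= /upd !eqxx/= gtn_eqF// (keeps_run st1 kpk : _ = _) addn1.
    have F0 : ireg (F st1) 0 = n.
      by rewrite /F/= /upd (negPf k0)/= (keeps_run st1 kp0 : _ = _).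
    have [|t' [e' b']] := IHr (F st1) F0; first by rewrite Fk addSnnS.
    exists ((t + (1 + 1)) + t').+1; split; last by rewrite E0 in b; lia.
    rewrite iterSr; apply: EWhileT e'; first by rewrite /= E0; lia.
    by apply: ESeq e _; apply: ESeq; exact: EInstr.
  have [|| t [e b]] := loop n (set_ireg st k 0).
  - by rewrite /= /upd (negPf k0).
  - by rewrite /= /upd eqxx.
  exists (1 + t)%N; split; first by apply: ESeq e; exact: EInstr.
  rewrite expnS; have : (0 < n ^ depth p)%N by rewrite expn_gt0 n0.
  by move: b; set N := (n ^ _)%N; nia.
Qed.

(** * The sweep *)

(** Invariant rule. The step is asked for every [st''] with the rational registers and output of the
    body, since the increment touches integer registers only; whatever the loop keeps is inherited
    from the entry state. *)
Lemma run_for k p (I : nat -> state -> Prop) st : (1 < k)%N -> keeps (LI k) p ->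
  I 0 (set_ireg st k 0) ->
  (forall q st', (q < ireg st 0)%N -> ireg st' k = q ->
     (forall l, keeps l (PFor k p) -> agree l st' st) ->
     I q st' -> forall st'', rreg st'' = rreg (run p st') -> out st'' = out (run p st') ->
     I q.+1 st'') ->
  I (ireg st 0) (run (PFor k p) st).
Proof.
move=> k1 kp I0 IS /=; set f := fun st' => _.
suff H r : (r <= ireg st 0)%N -> [/\ ireg (iter r f (set_ireg st k 0)) k = r,
    forall l, keeps l (PFor k p) -> agree l (iter r f (set_ireg st k 0)) st
    & I r (iter r f (set_ireg st k 0))] by case: (H _ (leqnn _)).
elim: r => [_|r IHr rn].
  split=> //; first by rewrite /= /upd eqxx.
  by move=> l /and3P[lk _ _]; apply: (@misses_instr l (IConst k 0)).
have [E A Ir] := IHr (ltnW rn); rewrite iterS {1 3}/f; split; last exact: (IS r _ rn E A Ir).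
  by rewrite /incr/= /upd !eqxx gtn_eqF//= (keeps_run _ kp : _ = _) E addn1.
move=> l kl; have /and3P[lk l1 lp] := kl.
exact: agree_trans (misses_incr _ lk l1) (agree_trans (keeps_run _ lp) (A l kl)).
Qed.

Section Model.
Variables (F : realFieldType) (P : nat -> 'I_3 -> F).
Implicit Types (i : 'I_3) (m l q n : nat) (u v a : F).

Definition ubreak i m q : F := P m i / P q (i + 1).
Definition vbreak i m q : F := P m i / P q (i + 2).

(* The point q beats m, or precedes it in a tie, on the weights where both are
   active in coordinate i. *)
Definition blocks i m q : bool :=
  (P q i < P m i) || (P q i == P m i) && (q < m)%N.

(* One pass over all points finds the right end of the slab starting at u and
   the height above which no point that reaches into this slab blocks m. *)
Definition sweep_step i m u (acc : F * F) q : F * F :=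
  if blocks i m q && (u < ubreak i m q)
  then (Num.min (ubreak i m q) acc.1, Num.max acc.2 (vbreak i m q)) else acc.

Definition sweep n i m u : F * F :=
  foldl (sweep_step i m u) (ubreak i m m, 0) (iota 0 n).

(** Once [ubreak P i m m] is reached the iteration is stationary; the surplus slabs are empty and
    [emits] drops them. *)
Definition slab n i m l : F := iter l (fun u => (sweep n i m u).1) 0.
Definition base_height n i m l : F := (sweep n i m (slab n i m l)).2.

(** The weight with w_i : w_j : w_k = 1 : u : v, without its third coordinate. As j and k follow i
    cyclically, the orientation is the same for all three i, and [quad] runs counterclockwise. *)
Definition pt i u v : F * F :=
  let d := 1 / (1 + u + v) in
  match val i with 0%N => (d, u * d) | 1%N => (v * d, d) | _ => (u * d, v * d) end.

Definition quad i u1 u2 v1 v2 : seq (F * F) :=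
  [:: pt i u1 v1; pt i u2 v1; pt i u2 v2; pt i u1 v2].

(** The triangle w_j >= u w_i, w_k >= v w_i extends to height h = 1 / (1 + u + v) in w_i. Its area
    is h / 2 and the mean of w_i on it is h / 3, which gives h^2 / 6. The products are associated as
    the machine forms them. *)
Definition corner a u v : F := 1 / (1 + u + v) * (1 / (1 + u + v)) * a / 6.

Definition quad_val a u1 u2 v1 v2 : F :=
  corner a u1 v1 - corner a u2 v1 + corner a u2 v2 - corner a u1 v2.

Definition emits n (t : 'I_3 * nat * nat) : bool :=
  let: (i, m, l) := t in
  (slab n i m l < slab n i m l.+1) && (base_height n i m l < vbreak i m m).

Definition cell_quad n (t : 'I_3 * nat * nat) : seq (F * F) :=
  let: (i, m, l) := t in
  quad i (slab n i m l) (slab n i m l.+1) (base_height n i m l) (vbreak i m m).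

Definition cell_val n (t : 'I_3 * nat * nat) : F :=
  let: (i, m, l) := t in
  quad_val (P m i) (slab n i m l) (slab n i m l.+1) (base_height n i m l) (vbreak i m m).

End Model.

(** The order is that of the nested loops, hence of the cells on the tape. *)
Definition triples n : seq ('I_3 * nat * nat) :=
  [seq (im, l) | im <- [seq (i, m) | i <- [:: 0; 1; 2 : 'I_3], m <- iota 0 n],
                 l <- iota 0 n].

(** * Register programs *)

Definition block (xs : seq instr) : prog := foldr (fun x => PSeq (PInstr x)) PSkip xs.

Definition load d m c : prog :=
  block [:: IAdd 5 m m; IAdd 5 5 m; IConst 6 c; IAdd 5 5 6; RLoad d 5].

Definition mov d a : prog := block [:: RConst 15 0; ROp OpAdd d a 15].

(** [vertex_prog] holds d, u d and v d of [pt] in registers 12, 13 and 14. *)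
Definition vertex_regs (i : 'I_3) : nat * nat :=
  match val i with 0%N => (12, 13) | 1%N => (14, 12) | _ => (13, 14) end%N.

Definition vertex_prog (o : arith) (i : 'I_3) (ru rv : nat) : prog :=
  block [:: RConst 11 1; ROp OpAdd 11 11 ru; ROp OpAdd 11 11 rv;
    RConst 12 1; ROp OpDiv 12 12 11; ROp OpMul 13 ru 12; ROp OpMul 14 rv 12;
    ROut (vertex_regs i).1; ROut (vertex_regs i).2;
    ROp OpMul 12 12 12; ROp OpMul 12 12 2; RConst 15 6; ROp OpDiv 12 12 15;
    ROp o 0 0 12].

Definition progs (ps : seq prog) : prog := foldr PSeq PSkip ps.

Definition header_prog (i : 'I_3) : prog :=
  progs [:: load 8 2 0; PInstr (ROut 8); load 8 2 1; PInstr (ROut 8);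
    load 8 2 2; PInstr (ROut 8);
    block [:: RConst 15 (i : nat)%:R; ROut 15; RConst 15 4; ROut 15]].

(* The rational register 2 holds the level of the active point, 3 and 4 its
   breaks, 5 and 6 the ends of the current slab and 7 the lower end of its cell;
   the integer registers 2, 3, 4 count points, slabs and competitors. *)
Definition emit_prog (i : 'I_3) : prog :=
  progs [:: header_prog i; vertex_prog OpAdd i 5 7; vertex_prog OpSub i 6 7;
    vertex_prog OpAdd i 6 4; vertex_prog OpSub i 5 4].

Definition breaks_prog (i : 'I_3) c m ru rv : prog :=
  progs [:: load c m i; load ru m (i + 1)%R; load rv m (i + 2)%R;
    block [:: ROp OpDiv ru 2 ru; ROp OpDiv rv 2 rv]].

Definition update_prog : prog :=
  PIf (RLt 5 9) (PSeq (PIf (RLt 9 6) (mov 6 9) PSkip)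
                      (PIf (RLt 7 10) (mov 7 10) PSkip)) PSkip.

Definition competitor_prog (i : 'I_3) : prog :=
  PSeq (breaks_prog i 8 4 9 10)
    (PIf (RLt 8 2) update_prog
       (PIf (REq 8 2) (PIf (ILt 4 2) update_prog PSkip) PSkip)).

Definition slab_prog (i : 'I_3) : prog :=
  progs [:: mov 6 3; PInstr (RConst 7 0); PFor 4 (competitor_prog i);
    PIf (RLt 5 6) (PIf (RLt 7 4) (emit_prog i) PSkip) PSkip; mov 5 6].

Definition point_prog (i : 'I_3) : prog :=
  progs [:: breaks_prog i 2 2 3 4; PInstr (RConst 5 0); PFor 3 (slab_prog i)].

Definition main_prog : prog :=
  progs [seq PFor 2 (point_prog i) | i <- [:: 0; 1; 2 : 'I_3]].

(** * Symbolic execution of the programs *)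

Lemma run_vertex o i ru rv st : (0 < ru < 8)%N -> (0 < rv < 8)%N ->
  let st' := run (vertex_prog o i ru rv) st in
  let u := rreg st ru in let v := rreg st rv in
  rreg st' 0 = arith_sem o (rreg st 0) (corner (rreg st 2) u v) /\
  out st' = out st ++ [:: (pt i u v).1; (pt i u v).2].
Proof.
move=> hu hv.
have E k : (7 < k)%N -> (ru == k = false) * (rv == k = false) by move=> ?; split; lia.
by case: i => -[|[|[|//]]] i3 /=; rewrite /upd/= !E//= -!cats1 -!catA.
Qed.

Section Run.
Variable s : seq 'rV[rat]_3.
Let n := size s.
Definition coords (m : nat) (c : 'I_3) : rat := (nth 0 s m) 0 c.
Let P := coords.

Definition in_env st := ireg st 0 = n /\ ram st = ram (input s).

Lemma run_load d mr (c : 'I_3) st : (mr < 5)%N -> in_env st ->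
  rreg (run (load d mr c) st) d = P (ireg st mr) c.
Proof.
move=> mr5 [_ E]; rewrite /= /upd !eqxx/=.
have -> : (mr == 5) = false by lia.
rewrite E /=; set m := ireg st mr; have c3 := ltn_ord c.
have -> : ((m + m + m + c) %/ 3 = m)%N by lia.
by have -> : ((m + m + m + c) %% 3 = c)%N by [lia|]; rewrite inord_val.
Qed.

Lemma env_run p st : keeps (LI 0) p -> keeps LRam p -> in_env st -> in_env (run p st).
Proof. move=> k0 kr [E1 E2]; split; first by rewrite (keeps_run st k0 : _ = _).
by rewrite (keeps_run st kr : _ = _). Qed.

Lemma run_header i st : in_env st ->
  out (run (header_prog i) st) = out st ++
    [seq nth 0 s (ireg st 2) 0 c | c <- enum 'I_3] ++ [:: (i : nat)%:R; 4].
Proof.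
move=> st_env.
pose p0 := load 8 2 0; pose p1 := load 8 2 1; pose p2 := load 8 2 2.
set st1 := run (PSeq p0 (PInstr (ROut 8))) st.
set st2 := run (PSeq p1 (PInstr (ROut 8))) st1.
set st3 := run (PSeq p2 (PInstr (ROut 8))) st2.
have e1 : in_env st1 by apply: env_run.
have e2 : in_env st2 by apply: env_run.
have -> : out (run (header_prog i) st) = out st3 ++ [:: (i : nat)%:R; 4].
  by rewrite /= /upd/= -!cats1 -!catA.
have -> : out st3 = out st2 ++ [:: P (ireg st2 2) 2].
  by rewrite -(@run_load 8 2 2)// cats1.
have -> : out st2 = out st1 ++ [:: P (ireg st1 2) 1].
  by rewrite -(@run_load 8 2 1)// cats1.
have -> : out st1 = out st ++ [:: P (ireg st 2) 0].
  by rewrite -(@run_load 8 2 0)// cats1.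
by rewrite !enum_ordSl enum_ord0 /= -!catA/=; congr (_ ++ [:: _, _, _ & _]);
  congr (fun_of_matrix _ _ _); apply: val_inj.
Qed.

End Run.

Section Run.
Variable s : seq 'rV[rat]_3.
Let n := size s.
Let P := coords s.

Definition cell_of (t : 'I_3 * nat * nat) : cell :=
  let: (i, m, l) := t in (nth 0 s m, i, cell_quad P n t).

Definition emitted (ts : seq ('I_3 * nat * nat)) : seq rat :=
  flatten [seq encode_cell (cell_of t) | t <- ts & emits P n t].

Definition emitted_val (ts : seq ('I_3 * nat * nat)) : rat :=
  \sum_(t <- ts | emits P n t) cell_val P n t.

Lemma keeps_rreg p st k : keeps (LR k) p -> rreg (run p st) k = rreg st k.
Proof. exact: (@keeps_run (LR k)). Qed.

(** Each vertex is printed and its signed [corner] term added in one go, with the signs alternating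
    around the quadrilateral as in [quad_val]. *)
Lemma run_emit i m l st : in_env s st -> ireg st 2 = m -> rreg st 2 = P m i ->
  rreg st 4 = vbreak P i m m -> rreg st 5 = slab P n i m l ->
  rreg st 6 = slab P n i m l.+1 -> rreg st 7 = base_height P n i m l ->
  rreg (run (emit_prog i) st) 0 = rreg st 0 + cell_val P n (i, m, l) /\
  out (run (emit_prog i) st) = out st ++ encode_cell (cell_of (i, m, l)).
Proof.
move=> senv Em E2 E4 E5 E6 E7.
rewrite /emit_prog /progs /foldr; cbn [run].
have := run_header i senv.
have := keeps_rreg (p := header_prog i) st.
set st1 := run (header_prog i) st; move: st1 => st1 K1 O1.
have [] := @run_vertex OpAdd i 5 7 st1 isT isT.
have := keeps_rreg (p := vertex_prog OpAdd i 5 7) st1.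
set st2 := run (vertex_prog _ _ _ _) st1; move: st2 => st2 K2 V2 O2.
have [] := @run_vertex OpSub i 6 7 st2 isT isT.
have := keeps_rreg (p := vertex_prog OpSub i 6 7) st2.
set st3 := run (vertex_prog _ _ _ _) st2; move: st3 => st3 K3 V3 O3.
have [] := @run_vertex OpAdd i 6 4 st3 isT isT.
have := keeps_rreg (p := vertex_prog OpAdd i 6 4) st3.
set st4 := run (vertex_prog _ _ _ _) st3; move: st4 => st4 K4 V4 O4.
have [] := @run_vertex OpSub i 5 4 st4 isT isT.
set st5 := run (vertex_prog _ _ _ _) st4; move: st5 => st5 V5 O5.
split.
  rewrite V5 V4 V3 V2 /= ?(K4, K3, K2, K1)// E2 E4 E5 E6 E7.
  by rewrite /quad_val !addrA.
rewrite O5 O4 O3 O2 O1 ?(K4, K3, K2, K1)// Em E4 E5 E6 E7 /encode_cell /=.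
by rewrite -!catA.
Qed.


(** The dividend is register 2 of the final state: for [c = 2] this is the level just loaded, for
    [c = 8] the level of the active point, loaded earlier. *)
Lemma run_breaks i (c mr ru rv : nat) st : in_env s st -> (mr < 5)%N -> uniq [:: c; ru; rv] ->
  ru != 2%N -> rv != 2%N ->
  let q := ireg st mr in forall st', st' = run (breaks_prog i c mr ru rv) st ->
  [/\ rreg st' c = P q i, rreg st' ru = rreg st' 2 / P q (i + 1)
    & rreg st' rv = rreg st' 2 / P q (i + 2)].
Proof.
move=> e0 mr5; rewrite 3!cons_uniq !inE negb_or !andbT => /andP[/andP[cu cv] uv] u2 v2.
have F (a b : nat) : a != b -> (a == b = false) * (b == a = false).
  by move=> ab; rewrite [b == a]eq_sym (negPf ab).
move=> q _ ->; rewrite /breaks_prog /progs /foldr; cbn [run].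
have := run_load c i mr5 e0; rewrite -/q.
have : in_env s (run (load c mr i) st) by exact: env_run.
have : ireg (run (load c mr i) st) mr = q.
  by apply: (@keeps_run (LI mr)); rewrite /= !andbT; lia.
set st1 := run (load c mr i) st; move: st1 => st1 q1 e1 E1.
have := run_load ru (i + 1) mr5 e1; rewrite q1.
have : in_env s (run (load ru mr (i + 1)%R) st1) by exact: env_run.
have : ireg (run (load ru mr (i + 1)%R) st1) mr = q.
  by rewrite -q1; apply: (@keeps_run (LI mr)); rewrite /= !andbT; lia.
have := @keeps_rreg (load ru mr (i + 1)%R) st1.
set st2 := run (load ru _ _) _; move: st2 => st2 K2 q2 e2 E2.
have := run_load rv (i + 2) mr5 e2; rewrite q2.
have := @keeps_rreg (load rv mr (i + 2)%R) st2.
set st3 := run (load rv _ _) _; move: st3 => st3 K3 E3.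
rewrite /= /upd/= !eqxx !(F _ _ cu) !(F _ _ cv) !(F _ _ uv) !(F _ _ u2) !(F _ _ v2).
by rewrite E3 (K3 c) ?(K3 ru) ?E2 ?(K2 c) ?E1 //= ?andbT.
Qed.

Lemma run_competitor i m u q st : in_env s st -> ireg st 2 = m -> ireg st 4 = q ->
  rreg st 2 = P m i -> rreg st 5 = u ->
  let st' := run (competitor_prog i) st in
  (rreg st' 6, rreg st' 7) = sweep_step P i m u (rreg st 6, rreg st 7) q.
Proof.
move=> e0 Em Eq E2 E5; rewrite /competitor_prog; cbn [run].
have [] := @run_breaks i 8 4 9 10 st e0 isT isT isT isT _ erefl; rewrite Eq.
rewrite !(@keeps_rreg (breaks_prog i 8 4 9 10) st 2)// E2.
have := @keeps_rreg (breaks_prog i 8 4 9 10) st.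
have : ireg (run (breaks_prog i 8 4 9 10) st) 2 = m.
  by rewrite -Em; apply: (@keeps_run (LI 2)).
have : ireg (run (breaks_prog i 8 4 9 10) st) 4 = q.
  by rewrite -Eq; apply: (@keeps_run (LI 4)).
set st1 := run _ st; move: st1 => st1 q1 m1 K1 E8 E9 E10.
have {}E2 : rreg st1 2 = P m i by rewrite K1.
have {}E5 : rreg st1 5 = u by rewrite K1.
rewrite -!(K1 6)// -!(K1 7)//.
rewrite /sweep_step /blocks -/(ubreak P i m q) in E9 *.
rewrite -/(vbreak P i m q) in E10.
(* Both ways of blocking, a lower level and a tie with a smaller index, run the same update. *)
have U : let st' := run update_prog st1 in (rreg st' 6, rreg st' 7) =
    if u < ubreak P i m q then
      (Num.min (ubreak P i m q) (rreg st1 6), Num.max (rreg st1 7) (vbreak P i m q))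
    else (rreg st1 6, rreg st1 7).
  rewrite /update_prog; cbn [run cond_sem]; rewrite E5 E9; case: ifP => // _.
  rewrite [Num.min _ _]/Order.min [Num.max _ _]/Order.max.
  by case: (ubreak P i m q < rreg st1 6); rewrite /= /upd/= E10;
    case: ifP => _ /=; rewrite /upd/= ?E9 ?E10 ?addr0.
cbn [run cond_sem]; rewrite E8 E2 q1 m1.
by case: ifP => _ /=; [|case: ifP => //= _; case: ifP => //= _]; rewrite U.
Qed.

Lemma run_sweep i m u st : in_env s st -> ireg st 2 = m -> rreg st 2 = P m i ->
  rreg st 5 = u -> rreg st 6 = ubreak P i m m -> rreg st 7 = 0 ->
  let st' := run (PFor 4 (competitor_prog i)) st in
  (rreg st' 6, rreg st' 7) = sweep P n i m u.
Proof.
move=> e0 Em E2 E5 E6 E7 st'; rewrite /sweep /n -e0.1.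
apply: (@run_for 4 _ (fun q st1 => (rreg st1 6, rreg st1 7) =
  foldl (sweep_step P i m u) (ubreak P i m m, 0) (iota 0 q))) => //.
  by rewrite /= E6 E7.
move=> q st1 qn Eq A I1 st2 -> _; rewrite -[q.+1]addn1 iotaD foldl_cat -I1.
apply: run_competitor => //.
- by split; [rewrite (A (LI 0) isT) e0.1|rewrite (A LRam isT) e0.2].
- by rewrite (A (LI 2) isT).
- by rewrite (A (LR 2) isT).
- by rewrite (A (LR 5) isT).
Qed.

Lemma emitted_cat ts1 ts2 : emitted (ts1 ++ ts2) = emitted ts1 ++ emitted ts2.
Proof. by rewrite /emitted filter_cat map_cat flatten_cat. Qed.

Lemma emitted_val_cat ts1 ts2 :
  emitted_val (ts1 ++ ts2) = emitted_val ts1 + emitted_val ts2.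
Proof. by rewrite /emitted_val big_cat. Qed.

Lemma emitted1 t : emitted [:: t] = if emits P n t then encode_cell (cell_of t) else [::].
Proof.
rewrite /emitted -[seq.filter _ _]/(if emits P n t then [:: t] else [::]).
by case: (emits P n t) => //; exact: (cats0 (encode_cell (cell_of t))).
Qed.

Lemma emitted_val1 t : emitted_val [:: t] = if emits P n t then cell_val P n t else 0.
Proof. by rewrite /emitted_val big_cons big_nil addr0. Qed.

(** This relation composes along concatenation, so each loop merely appends its triples. *)
Definition extends ts (st st' : state) :=
  rreg st' 0 = rreg st 0 + emitted_val ts /\ out st' = out st ++ emitted ts.

Lemma extends0 st st' : rreg st' 0 = rreg st 0 -> out st' = out st -> extends [::] st st'.
Proof. by move=> e1 e2; split; rewrite /emitted_val ?e1 ?e2 ?big_nil ?addr0 ?cats0. Qed.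

Lemma extends_cat ts1 ts2 st1 st2 st3 :
  extends ts1 st1 st2 -> extends ts2 st2 st3 -> extends (ts1 ++ ts2) st1 st3.
Proof.
move=> [e1 o1] [e2 o2].
by split; rewrite ?emitted_cat ?emitted_val_cat ?e2 ?o2 ?e1 ?o1 ?addrA ?catA.
Qed.

Lemma run_slab i m l st : in_env s st -> ireg st 2 = m ->
  rreg st 2 = P m i -> rreg st 3 = ubreak P i m m -> rreg st 4 = vbreak P i m m ->
  rreg st 5 = slab P n i m l ->
  forall st', st' = run (slab_prog i) st ->
  rreg st' 5 = slab P n i m l.+1 /\ extends [:: (i, m, l)] st st'.
Proof.
move=> e0 Em E2 E3 E4 E5 _ ->.
set st1 := run (PInstr (RConst 7 0)) (run (mov 6 3) st).
set finish := PIf (RLt 5 6) (PIf (RLt 7 4) (emit_prog i) PSkip) PSkip.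
rewrite -[run (slab_prog i) st]/(run (mov 5 6) (run finish (run (PFor 4 (competitor_prog i)) st1))).
have {}e0 : in_env s st1 by [].
have {}Em : ireg st1 2 = m by [].
have E6 : rreg st1 6 = ubreak P i m m by rewrite /= /upd/= addr0.
have E7 : rreg st1 7 = 0 by [].
have {}E2 : rreg st1 2 = P m i by [].
have {}E4 : rreg st1 4 = vbreak P i m m by [].
have {}E5 : rreg st1 5 = slab P n i m l by [].
have R0 : rreg st1 0 = rreg st 0 by [].
have O0 : out st1 = out st by [].
rewrite /extends -R0 -O0.
move: {E3 R0 O0} st1 e0 Em E2 E4 E5 E6 E7 => {}st e0 Em E2 E4 E5 E6 E7.
have := run_sweep e0 Em E2 E5 E6 E7.
have := @keeps_run LOut (PFor 4 (competitor_prog i)) st isT.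
have : in_env s (run (PFor 4 (competitor_prog i)) st) by exact: env_run.
have := @keeps_rreg (PFor 4 (competitor_prog i)) st.
have := @keeps_run (LI 2) (PFor 4 (competitor_prog i)) st isT.
cbv zeta; set st1 := run (PFor _ _) st; rewrite /agree.
move: st1 => st1 m1 K1 e1 <- S1.
have {}E5 : rreg st1 5 = slab P n i m l by rewrite K1.
have {}E4 : rreg st1 4 = vbreak P i m m by rewrite K1.
have {}E2 : rreg st1 2 = P m i by rewrite K1.
rewrite -(K1 0)//; rewrite Em in m1.
have {}E6 : rreg st1 6 = slab P n i m l.+1 by rewrite [LHS](congr1 fst S1).
have {}E7 : rreg st1 7 = base_height P n i m l by rewrite [LHS](congr1 snd S1).
set st2 := run finish st1.
have [E6' X] : rreg st2 6 = rreg st1 6 /\ extends [:: (i, m, l)] st1 st2.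
  rewrite /st2 /finish; cbn [run cond_sem]; rewrite E4 E5 E6 E7.
  rewrite /extends emitted1 emitted_val1 /emits.
  case: ltP => _; last by rewrite andFb addr0 cats0.
  case: ltP => _; last by rewrite andbF addr0 cats0.
  have [-> ->] := run_emit e1 m1 E2 E4 E5 E6 E7.
  by rewrite keeps_rreg.
split; first by rewrite /= /upd/= E6' E6 addr0.
exact: X.
Qed.

Definition row (i : 'I_3) m r : seq ('I_3 * nat * nat) := [seq ((i, m), l) | l <- iota 0 r].

Lemma run_point i m st : in_env s st -> ireg st 2 = m ->
  extends (row i m n) st (run (point_prog i) st).
Proof.
move=> e0 Em.
rewrite -[run (point_prog i) st]/(run (PFor 3 (slab_prog i))
  (run (PInstr (RConst 5 0)) (run (breaks_prog i 2 2 3 4) st))).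
have := @run_breaks i 2 2 3 4 st e0 isT isT isT isT _ erefl; rewrite Em.
have := @keeps_run LOut (breaks_prog i 2 2 3 4) st isT.
have := @keeps_run (LI 2) (breaks_prog i 2 2 3 4) st isT.
have : in_env s (run (breaks_prog i 2 2 3 4) st) by exact: env_run.
have := @keeps_rreg (breaks_prog i 2 2 3 4) st 0 isT.
set st1 := run _ st; move: st1 => st1; rewrite /agree Em /extends => <- e1 m1 <- [E2].
rewrite E2 -/(ubreak P i m m) -/(vbreak P i m m) => E3 E4.
rewrite -/(extends (row i m n) st1 _).
set st2 := run (PInstr _) st1.
have {}e1 : in_env s st2 by [].
rewrite {1}/n -e1.1.
suff [] : rreg (run (PFor 3 (slab_prog i)) st2) 5 = slab P n i m (ireg st2 0) /\
  extends (row i m (ireg st2 0)) st1 (run (PFor 3 (slab_prog i)) st2) by [].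
apply: (@run_for 3 _ (fun l st' => rreg st' 5 = slab P n i m l /\
  extends (row i m l) st1 st')) => //.
  by split=> //; exact: extends0.
move=> l st' ln El A [E5 X] st'' R O.
have e' : in_env s st'.
  by split; [rewrite (A (LI 0) isT) e1.1|rewrite (A LRam isT) e1.2].
have Em' : ireg st' 2 = m by rewrite (A (LI 2) isT).
have E2' : rreg st' 2 = P m i by rewrite (A (LR 2) isT).
have E3' : rreg st' 3 = ubreak P i m m by rewrite (A (LR 3) isT).
have E4' : rreg st' 4 = vbreak P i m m by rewrite (A (LR 4) isT).
have [E5' X'] := run_slab e' Em' E2' E3' E4' E5 erefl.
rewrite /extends R O; split=> //; rewrite /row -[l.+1]addn1 iotaD map_cat.
exact: extends_cat X X'.
Qed.

Definition rows (i : 'I_3) r : seq ('I_3 * nat * nat) := flatten [seq row i m n | m <- iota 0 r].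

Lemma run_points i st : in_env s st ->
  extends (rows i n) st (run (PFor 2 (point_prog i)) st).
Proof.
move=> e0; rewrite {1}/n -e0.1.
apply: (@run_for 2 _ (fun m st' => extends (rows i m) st st')) => //.
  exact: extends0.
move=> m st' mn Em A X st'' R O; rewrite /extends R O /rows -[m.+1]addn1 iotaD map_cat flatten_cat.
apply: (extends_cat X); rewrite -[flatten _]/(row i m n ++ [::]) cats0.
apply: run_point => //.
by split; [rewrite (A (LI 0) isT) e0.1|rewrite (A LRam isT) e0.2].
Qed.

Lemma triplesE : triples n = rows 0 n ++ rows 1 n ++ rows 2 n ++ [::].
Proof.
by rewrite /triples /= !map_cat !flatten_cat /rows /row -!map_comp.
Qed.

Lemma run_main : extends (triples n) (input s) (run main_prog (input s)).
Proof.
have e0 : in_env s (input s) by [].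
rewrite triplesE.
rewrite -[run main_prog _]/(run (PFor 2 (point_prog 2)) (run (PFor 2 (point_prog 1))
  (run (PFor 2 (point_prog 0)) (input s)))).
have X0 := run_points 0 e0.
have e1 : in_env s (run (PFor 2 (point_prog 0)) (input s)) by exact: env_run.
have X1 := run_points 1 e1.
have e2 : in_env s (run (PFor 2 (point_prog 1)) (run (PFor 2 (point_prog 0)) (input s))).
  exact: env_run.
have X2 := run_points 2 e2.
apply: (extends_cat X0); apply: (extends_cat X1); apply: (extends_cat X2).
exact: extends0.
Qed.

End Run.

Lemma wf_main : wf main_prog.
Proof. by []. Qed.

Lemma keeps0_main : keeps (LI 0) main_prog.
Proof. by []. Qed.

(** Points, slabs and competitors nest; the coordinate is unrolled in [main_prog]. *)
Lemma depth_main : depth main_prog = 3.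
Proof. by []. Qed.

(** * Slabs *)

Section Slabs.
Variables (F : realFieldType) (P : nat -> 'I_3 -> F) (n : nat).
Hypothesis P_gt0 : forall m c, (m < n)%N -> 0 < P m c.
Variables (i : 'I_3) (m : nat).
Hypothesis mn : (m < n)%N.

Let X := ubreak P i m.
Let Y := vbreak P i m.
Let U := slab P n i m.
Let V := base_height P n i m.

Lemma ubreak_gt0 q : (q < n)%N -> 0 < X q.
Proof. by move=> qn; rewrite divr_gt0 // P_gt0. Qed.

(** Stated for partial passes, as the invariant of the sweep. The weak bound [u <= a] stands beside
    the strict one because a slab may start at [X m]. *)
Lemma sweepP r u : (r <= n)%N -> let: (a, v) := sweep P r i m u in
  [/\ [/\ a <= X m, 0 <= v, u <= X m -> u <= a & u < X m -> u < a],
      forall q, (q < r)%N -> blocks P i m q -> u < X q -> a <= X q /\ Y q <= v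
    & exists2 q, (q < n)%N & a = X q].
Proof.
rewrite /sweep; elim: r => [_|r IH rn].
  by split=> //; exists m.
rewrite -[r.+1]addn1 iotaD foldl_cat; move: (IH (ltnW rn)).
case: (foldl _ _ (iota 0 r)) => a v [[aX v0 ua' ua] H [q0 q0n Ea]] /=.
rewrite add0n /sweep_step /=; case: ifPn => [/andP[br ur]|nb].
  split; last by rewrite /Order.min; case: ifP => _; [exists r|exists q0].
    split.
    - by rewrite ge_min aX orbT.
    - by rewrite le_max v0.
    - by move=> um; rewrite le_min (ltW ur) ua'.
    by move=> um; rewrite lt_min ur ua.
  move=> q; rewrite addn1 ltnS leq_eqVlt => /predU1P[-> _ _|qr bq uq].
    by rewrite ge_min lexx le_max lexx orbT.
  have [? ?] := H _ qr bq uq; by rewrite ge_min le_max; split; apply/orP; [right|left].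
split=> //; last by exists q0.
move=> q; rewrite addn1 ltnS leq_eqVlt => /predU1P[-> bq uq|]; last exact: H.
by rewrite /X in uq; rewrite bq uq in nb.
Qed.

Lemma slabS l : U l.+1 = (sweep P n i m (U l)).1. Proof. by []. Qed.

Lemma slab_le l : U l <= X m.
Proof.
case: l => [|l]; first exact/ltW/ubreak_gt0.
by rewrite slabS; have := sweepP (U l) (leqnn n); case: (sweep _ _ _ _ _) => a v [[]].
Qed.

Lemma slab_lt l : U l < X m -> U l < U l.+1.
Proof.
rewrite slabS; have := sweepP (U l) (leqnn n).
by case: (sweep _ _ _ _ _) => a v [[_ _ _ H] _ _] /H.
Qed.

Lemma slab_leS l : U l <= U l.+1.
Proof.
rewrite slabS; have := sweepP (U l) (leqnn n).
by case: (sweep _ _ _ _ _) => a v [[_ _ H _] _ _]; exact: H (slab_le l).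
Qed.

Lemma slab_homo l l' : (l <= l')%N -> U l <= U l'.
Proof. by move: l l'; apply: (homo_leq le_refl le_trans) => l; exact: slab_leS. Qed.

Lemma slab_ge0 l : 0 <= U l. Proof. exact: (@slab_homo 0). Qed.

Lemma slab_break l : exists2 q, (q < n)%N & U l.+1 = X q.
Proof.
by rewrite slabS; have := sweepP (U l) (leqnn n); case: (sweep _ _ _ _ _) => a v [].
Qed.

Lemma base_height_ge0 l : 0 <= V l.
Proof.
by rewrite /V/base_height; have := sweepP (U l) (leqnn n); case: (sweep _ _ _ _ _) => a v [[]].
Qed.

(** No break of a blocker falls strictly inside a slab: its quadrant either ends left of the slab or
    spans the whole width, and then its height is at most the floor. Hence one floor per slab
    suffices and cells are rectangles in (u, v). *)
Lemma blocksP l q : (q < n)%N -> blocks P i m q ->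
  X q <= U l \/ U l.+1 <= X q /\ Y q <= V l.
Proof.
move=> qn bq; rewrite slabS /V/base_height; have := sweepP (U l) (leqnn n).
by case: (sweep _ _ _ _ _) => a v [_ H _]; have [|/(H _ qn bq)] := leP (X q) (U l); [left|right].
Qed.

(** The floor is not too high either: unless it is 0, it is the height of a blocker that does reach
    into the slab. Covering depends on this. *)
Lemma base_height_attained l : V l = 0 \/
  exists q, [/\ (q < n)%N, blocks P i m q, U l < X q & V l = Y q].
Proof.
rewrite /V/base_height/sweep; suff H r : (r <= n)%N ->
    let v := (foldl (sweep_step P i m (U l)) (X m, 0) (iota 0 r)).2 in
    v = 0 \/ exists q, [/\ (q < n)%N, blocks P i m q, U l < X q & v = Y q] by exact: H.
elim: r => [|r IH] rn; first by left.
rewrite -[r.+1]addn1 iotaD foldl_cat; move: (IH (ltnW rn)).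
case: (foldl _ _ (iota 0 r)) => a v /= H.
rewrite add0n /sweep_step /=; case: ifPn => //= /andP[br ur].
by rewrite /Order.max; case: ifP => // _; right; exists r.
Qed.

(** Pigeonhole: otherwise [U 1 < ... < U n < X m] would be n + 1 distinct values among the n breaks
    [X q]. *)
Lemma slab_last : U n = X m.
Proof.
apply/eqP; rewrite eq_le slab_le leNgt; apply/negP => UX.
have lt l : (l <= n)%N -> U l < U l.+1.
  by move=> ln; apply: slab_lt; apply: le_lt_trans UX; exact: slab_homo.
pose vs := X m :: [seq U l.+1 | l <- iota 0 n].
have Uinj l l' : (l < l' < n)%N -> U l.+1 < U l'.+1.
  move=> /andP[ll l'n]; apply: le_lt_trans (lt _ (ltnW l'n)); exact: slab_homo.
have vs_uniq : uniq vs.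
  rewrite /vs cons_uniq; apply/andP; split.
    apply/mapP => -[l]; rewrite mem_iota add0n => /andP[_ ln] E.
    by have := slab_homo ln; rewrite -E leNgt UX.
  rewrite map_inj_in_uniq ?iota_uniq// => l l'.
  rewrite !mem_iota !add0n => /andP[_ ln] /andP[_ l'n] E.
  by have [h|h|//] := ltngtP l l';
    [have := @Uinj l l'|have := @Uinj l' l]; rewrite h ?ln ?l'n E ltxx => /(_ isT).
have := @uniq_leq_size _ vs [seq X q | q <- iota 0 n] vs_uniq.
rewrite [size vs]/= !size_map size_iota ltnn => H.
suff /H : {subset vs <= [seq X q | q <- iota 0 n]} by [].
move=> z; rewrite inE => /predU1P[->|/mapP[l _ ->]].
  by apply: map_f; rewrite mem_iota.
by have [q qn ->] := slab_break l; apply: map_f; rewrite mem_iota.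
Qed.

Lemma slab_cover u : 0 <= u < X m -> exists2 l, (l < n)%N & U l <= u < U l.+1.
Proof.
move=> /andP[u0]; rewrite -slab_last; elim: n => [|r IH]; first by rewrite ltNge u0.
have [/IH[l lr h] _|h1 h2] := ltP u (U r); first by exists l => //; rewrite ltnS ltnW.
by exists r => //; rewrite h1.
Qed.

End Slabs.

(** * Cells *)

Section Quads.
Variable R : realType.
Implicit Types (i c : 'I_3) (x : R * R) (u v : R).

Definition bary c x : R := chart x 0 c.

Lemma bary_sum i x : bary i x + bary (i + 1) x + bary (i + 2) x = 1.
Proof. by case: i => -[|[|[|//]]] ? /=; rewrite /bary !mxE /=; ring. Qed.

Lemma ord3_cases i c : [\/ c = i, c = i + 1 | c = i + 2].
Proof.
case: i => -[|[|[|//]]] hi; case: c => -[|[|[|//]]] hc;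
  solve [constructor 1; exact: val_inj | constructor 2; exact: val_inj
        | constructor 3; exact: val_inj].
Qed.

Lemma bary_pt i u v : 1 + u + v != 0 ->
  [/\ bary i (pt i u v) = 1 / (1 + u + v), bary (i + 1) (pt i u v) = u / (1 + u + v)
    & bary (i + 2) (pt i u v) = v / (1 + u + v)].
Proof.
by move=> h; case: i => -[|[|[|//]]] ? /=; rewrite /bary !mxE /=; split; field.
Qed.

(** The numerator is the determinant with rows (1, u, v), (1, u', v') and the weight of x read in
    the order i, i + 1, i + 2. That order is an even permutation, so one formula covers all three
    coordinates. *)
Lemma orient_pt i u v u' v' x : 1 + u + v != 0 -> 1 + u' + v' != 0 ->
  orient (pt i u v) (pt i u' v') x =
  (bary i x * (u * v' - v * u') - bary (i + 1) x * (v' - v) + bary (i + 2) x * (u' - u))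
  / ((1 + u + v) * (1 + u' + v')).
Proof.
move=> h h'; case: i => -[|[|[|//]]] ? /=; rewrite /orient /bary !mxE /=; field;
  by rewrite h h'.
Qed.

Section Quad.
Variables (i : 'I_3) (u1 u2 v1 v2 : R).
Hypotheses (u10 : 0 <= u1) (u12 : u1 < u2) (v10 : 0 <= v1) (v12 : v1 < v2).

Definition in_quad x :=
  [/\ u1 * bary i x <= bary (i + 1) x, bary (i + 1) x <= u2 * bary i x,
      v1 * bary i x <= bary (i + 2) x & bary (i + 2) x <= v2 * bary i x].

Lemma quad_edges : edges (quad i u1 u2 v1 v2) =
  [:: (pt i u1 v1, pt i u2 v1); (pt i u2 v1, pt i u2 v2);
      (pt i u2 v2, pt i u1 v2); (pt i u1 v2, pt i u1 v1)].
Proof. by []. Qed.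

Let d11 : 0 < 1 + u1 + v1. Proof. by move: u10 u12 v10 v12; lra. Qed.
Let d21 : 0 < 1 + u2 + v1. Proof. by move: u10 u12 v10 v12; lra. Qed.
Let d22 : 0 < 1 + u2 + v2. Proof. by move: u10 u12 v10 v12; lra. Qed.
Let d12 : 0 < 1 + u1 + v2. Proof. by move: u10 u12 v10 v12; lra. Qed.

(** Each edge keeps u or v constant, so its orientation form factors into the slack of one
    inequality of [in_quad] and a positive constant. *)
Lemma orient_quad x :
  [/\ orient (pt i u1 v1) (pt i u2 v1) x =
        (bary (i + 2) x - v1 * bary i x) * ((u2 - u1) / ((1 + u1 + v1) * (1 + u2 + v1))),
      orient (pt i u2 v1) (pt i u2 v2) x =
        (u2 * bary i x - bary (i + 1) x) * ((v2 - v1) / ((1 + u2 + v1) * (1 + u2 + v2))),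
      orient (pt i u2 v2) (pt i u1 v2) x =
        (v2 * bary i x - bary (i + 2) x) * ((u2 - u1) / ((1 + u2 + v2) * (1 + u1 + v2)))
    & orient (pt i u1 v2) (pt i u1 v1) x =
        (bary (i + 1) x - u1 * bary i x) * ((v2 - v1) / ((1 + u1 + v2) * (1 + u1 + v1)))].
Proof.
by split; rewrite orient_pt ?lt0r_neq0 // mulrA; congr (_ / _); ring.
Qed.

Let e1 : 0 < (u2 - u1) / ((1 + u1 + v1) * (1 + u2 + v1)).
Proof. by rewrite divr_gt0 ?mulr_gt0 ?subr_gt0. Qed.
Let e2 : 0 < (v2 - v1) / ((1 + u2 + v1) * (1 + u2 + v2)).
Proof. by rewrite divr_gt0 ?mulr_gt0 ?subr_gt0. Qed.
Let e3 : 0 < (u2 - u1) / ((1 + u2 + v2) * (1 + u1 + v2)).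
Proof. by rewrite divr_gt0 ?mulr_gt0 ?subr_gt0. Qed.
Let e4 : 0 < (v2 - v1) / ((1 + u1 + v2) * (1 + u1 + v1)).
Proof. by rewrite divr_gt0 ?mulr_gt0 ?subr_gt0. Qed.

Lemma quad_regionP x : polygon_region (quad i u1 u2 v1 v2) x <-> in_quad x.
Proof.
have [E1 E2 E3 E4] := orient_quad x; split.
  move=> H; split.
  - have := H (pt i u1 v2, pt i u1 v1); rewrite quad_edges !inE eqxx !orbT E4.
    by rewrite pmulr_lge0// subr_ge0 => /(_ isT).
  - have := H (pt i u2 v1, pt i u2 v2); rewrite quad_edges !inE eqxx !orbT E2.
    by rewrite pmulr_lge0// subr_ge0 => /(_ isT).
  - have := H (pt i u1 v1, pt i u2 v1); rewrite quad_edges !inE eqxx ?orbT E1.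
    by rewrite pmulr_lge0// subr_ge0 => /(_ isT).
  - have := H (pt i u2 v2, pt i u1 v2); rewrite quad_edges !inE eqxx !orbT E3.
    by rewrite pmulr_lge0// subr_ge0 => /(_ isT).
move=> [h1 h2 h3 h4] e; rewrite quad_edges !inE => /or4P[] /eqP -> /=.
- by rewrite E1 pmulr_lge0// subr_ge0.
- by rewrite E2 pmulr_lge0// subr_ge0.
- by rewrite E3 pmulr_lge0// subr_ge0.
- by rewrite E4 pmulr_lge0// subr_ge0.
Qed.

Lemma pt_neq (u v u' v' : R) : 0 < 1 + u + v -> 0 < 1 + u' + v' ->
  (u != u') || (v != v') -> pt i u v != pt i u' v'.
Proof.
move=> h h' uv; apply/negP => /eqP E.
have [a b c] := @bary_pt i u v (lt0r_neq0 h).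
have [a' b' c'] := @bary_pt i u' v' (lt0r_neq0 h').
rewrite E a' in a; rewrite E b' in b; rewrite E c' in c.
have D : 1 + u + v = 1 + u' + v'.
  by apply: invr_inj; rewrite -[LHS]mul1r -a mul1r.
have D0 := lt0r_neq0 h; move: uv b c; rewrite -D.
by move=> + /(divIf D0) eu /(divIf D0) ev; rewrite eu ev !eqxx.
Qed.

Lemma quad_convex : convex_polygon (quad i u1 u2 v1 v2).
Proof.
have u21 : u2 != u1 by rewrite gt_eqF.
have v21 : v2 != v1 by rewrite gt_eqF.
split=> //.
  by rewrite /= !inE !negb_or !andbT !pt_neq//= ?(eq_sym u1) ?(eq_sym v1) ?u21 ?v21 ?orbT.
have [a b c] := @bary_pt i u1 v1 (lt0r_neq0 d11).
have [a' b' c'] := @bary_pt i u2 v1 (lt0r_neq0 d21).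
have [a'' b'' c''] := @bary_pt i u2 v2 (lt0r_neq0 d22).
have [a3 b3 c3] := @bary_pt i u1 v2 (lt0r_neq0 d12).
have P (p q d : R) : 0 < d -> (0 < p / d - q * (1 / d)) = (q < p).
  by move=> d0; rewrite mulrA mulr1 -mulrBl pmulr_lgt0 ?invr_gt0// subr_gt0.
have P' (p q d : R) : 0 < d -> (0 < q * (1 / d) - p / d) = (p < q).
  by move=> d0; rewrite mulrA mulr1 -mulrBl pmulr_lgt0 ?invr_gt0// subr_gt0.
move=> e; rewrite quad_edges !inE => /or4P[] /eqP -> x; rewrite !inE => /or4P[] /eqP -> /=;
  rewrite ?eqxx // => _ _.
all: match goal with |- is_true (0 < orient _ _ ?y) =>
       case: (orient_quad y) => o1 o2 o3 o4 end.
all: rewrite ?(o1, o2, o3, o4) pmulr_lgt0 // ?(a, b, c, a', b', c', a'', b'', c'', a3, b3, c3).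
all: by rewrite ?P ?P'.
Qed.

(** The two bounds on w_j force [bary i x >= 0]; at 0 the four bounds would make all three weights
    vanish, against their sum being 1. *)
Lemma in_quad_gt0 x : in_quad x -> 0 < bary i x.
Proof.
move=> [h1 h2 h3 h4]; have S := bary_sum i x.
have : 0 <= (u2 - u1) * bary i x by rewrite mulrBl subr_ge0 (le_trans h1).
rewrite pmulr_rge0 ?subr_gt0// le_eqVlt => /predU1P[b0|//].
by move: h1 h2 h3 h4 S; rewrite -b0 !mulr0; lra.
Qed.

Lemma in_quad_ge0 x c : in_quad x -> 0 <= bary c x.
Proof.
move=> h; have b0 := in_quad_gt0 h; case: h => h1 _ h3 _.
have [->|->|->] := ord3_cases i c; first exact: ltW.
- by apply: le_trans h1; rewrite mulr_ge0// ltW.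
- by apply: le_trans h3; rewrite mulr_ge0// ltW.
Qed.


End Quad.
End Quads.

Section Cells.
Variables (R : realType) (P : nat -> 'I_3 -> R) (n : nat).
Hypothesis P_gt0 : forall m c, (m < n)%N -> 0 < P m c.
Implicit Types (i c : 'I_3) (m l q : nat) (x : R * R) (t : 'I_3 * nat * nat).

Definition degenerate x := exists m q c c',
  [/\ (m < n)%N, (q < n)%N, c != c' & bary c x * P m c = bary c' x * P q c'].

Definition in_cell t x :=
  let: (i, m, l) := t in
  in_quad i (slab P n i m l) (slab P n i m l.+1) (base_height P n i m l) (vbreak P i m m) x.

(** The point [m] realises the envelope at x through coordinate i, expressed by witnesses instead of
    maxima and minima; [tau_active] translates it. *)
Definition active i m x :=
  (forall c, bary c x * P m c <= bary i x * P m i) /\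
  (forall q, (q < n)%N -> exists c, bary i x * P m i <= bary c x * P q c).

Lemma le_break (a p b w : R) : 0 < p -> (a / p * b <= w) = (b * a <= w * p).
Proof. by move=> p0; rewrite mulrAC ler_pdivrMr// [a * b]mulrC. Qed.

Lemma ge_break (a p b w : R) : 0 < p -> (w <= a / p * b) = (w * p <= b * a).
Proof. by move=> p0; rewrite mulrAC ler_pdivlMr// [a * b]mulrC. Qed.

Lemma mem_triples i m l : ((i, m, l) \in triples n) = (m < n)%N && (l < n)%N.
Proof.
rewrite /triples; apply/allpairsP/andP => [[[[i1 m1] l1] [+ + [_ -> ->]]]|[mn ln]].
  move=> /allpairsP[[i2 m2] /= [_ + [_ ->]]]; rewrite !mem_iota !add0n => /andP[_ ?] /andP[_ ?].
  by split.
exists ((i, m), l); split; rewrite ?mem_iota//.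
apply/allpairsP; exists (i, m); split; rewrite ?mem_iota//= !inE.
by case: (ord3_cases 0 i) => ->; rewrite ?eqxx ?orbT.
Qed.

Lemma triples_uniq : uniq (triples n).
Proof.
apply: allpairs_uniq; rewrite ?iota_uniq//; last by move=> [? ?] [? ?] _ _ [-> ->].
by apply: allpairs_uniq; rewrite ?iota_uniq// => -[? ?] [? ?] _ _ [-> ->].
Qed.

Lemma emits_quad i m l : (m < n)%N -> emits P n (i, m, l) ->
  [/\ 0 <= slab P n i m l, slab P n i m l < slab P n i m l.+1, 0 <= base_height P n i m l
    & base_height P n i m l < vbreak P i m m].
Proof.
move=> mn /andP[h1 h2]; split; [exact: slab_ge0|exact: h1|exact: base_height_ge0 mn _|exact: h2].
Qed.

(** The right and top sides stay within the breaks of m, which makes i its largest coordinate. A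
    point that does not block m is at least as high in coordinate i. A blocker reaches the value of
    m in coordinate i + 1 if its quadrant ends left of the slab, and in i + 2 if it is under the
    floor. *)
Lemma cell_active i m l x : (m < n)%N -> emits P n (i, m, l) -> in_cell (i, m, l) x ->
  active i m x.
Proof.
move=> mn /(emits_quad mn)[u0 u12 v0 v12] H.
have b0 := in_quad_gt0 u12 H; case: H => h1 h2 h3 h4; split.
  move=> c; have [->|->|->] := ord3_cases i c => //.
  - rewrite -ge_break ?P_gt0//; apply: le_trans h2 _.
    by rewrite ler_wpM2r ?(ltW b0)//; exact: slab_le.
  - by rewrite -ge_break ?P_gt0.
move=> q qn; have [bq|] := boolP (blocks P i m q); last first.
  by rewrite negb_or -leNgt => /andP[h _]; exists i; rewrite ler_wpM2l// ltW.
have [h|[_ h]] := blocksP mn l qn bq.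
- exists (i + 1); rewrite -le_break ?P_gt0//; apply: le_trans h1.
  by rewrite ler_wpM2r// ltW.
- exists (i + 2); rewrite -le_break ?P_gt0//; apply: le_trans h3.
  by rewrite ler_wpM2r// ltW.
Qed.

Lemma bary_gt0_ex x : (forall c, 0 <= bary c x) -> exists c, 0 < bary c x.
Proof.
move=> h; have S := bary_sum 0 x.
have [h0|h0] := ltP 0 (bary 0 x); first by exists 0.
have [h1|h1] := ltP 0 (bary (0 + 1) x); first by exists (0 + 1).
by exists (0 + 2); move: S h0 h1; lra.
Qed.

(** Taking the smallest index among the minimizers matches the tie rule of [blocks]. *)
Lemma first_argmin (g : nat -> R) : (0 < n)%N -> exists2 m, (m < n)%N &
  forall q, (q < n)%N -> g m <= g q /\ ((q < m)%N -> g m < g q).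
Proof.
elim: n => // k IH _; have [->|/IH[m mk H]] := posnP k.
  by exists 0%N => // -[|//] _; split.
have [le|lt] := leP (g m) (g k).
  exists m; first exact: ltnW.
  move=> q; rewrite ltnS leq_eqVlt => /predU1P[->|/H//]; split=> //.
  by rewrite ltnNge (ltnW mk).
exists k => // q; rewrite ltnS leq_eqVlt => /predU1P[->|/H[h _]]; first by rewrite ltnn.
by split=> [|_]; [apply: ltW|]; apply: lt_le_trans lt h.
Qed.

Lemma max_coord m x : exists i, forall c, bary c x * P m c <= bary i x * P m i.
Proof.
have [i _ H] := @arg_maxP _ R 'I_3 0 xpredT (fun c => bary c x * P m c) isT.
by exists i => c; apply: H.
Qed.

Lemma cells_cover x : (0 < n)%N -> (forall c, 0 <= bary c x) -> ~ degenerate x ->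
  exists2 t, (t \in triples n) && emits P n t & in_cell t x.
Proof.
move=> n0 x0 nd.
pose g m := \big[Num.max/bary 0 x * P m 0]_(c < 3) (bary c x * P m c).
have gE m i : (forall c, bary c x * P m c <= bary i x * P m i) -> g m = bary i x * P m i.
  move=> H; apply/eqP; rewrite eq_le /g; apply/andP; split; last exact: le_bigmax_cond.
  by apply: bigmax_le.
have [m mn Hm] := first_argmin g n0; have [i Hi] := max_coord m x.
have gm := gE _ _ Hi.
have bi0 : 0 < bary i x.
  have [c c0] := bary_gt0_ex x0.
  have := lt_le_trans (mulr_gt0 c0 (P_gt0 c mn)) (Hi c).
  by rewrite pmulr_lgt0 ?P_gt0.
pose u := bary (i + 1) x / bary i x; pose v := bary (i + 2) x / bary i x.
have uE (a b : R) : (a <= u) = (a * bary i x <= bary (i + 1) x) by rewrite ler_pdivlMr.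
(* Nondegeneracy makes the bounds by the breaks of m strict, as [slab_cover] and [emits] require. *)
have uX q : (q < n)%N -> u != ubreak P i m q.
  move=> qn; apply/negP => /eqP E; apply: nd; exists m, q, i, (i + 1); split=> //.
    by case: {+}i => -[|[|[|//]]].
  have : u * bary i x = bary (i + 1) x by rewrite mulfVK// gt_eqF.
  by rewrite E => <-; rewrite /ubreak; field; rewrite gt_eqF// P_gt0.
have vY : v != vbreak P i m m.
  apply/negP => /eqP E; apply: nd; exists m, m, i, (i + 2); split=> //.
    by case: {+}i => -[|[|[|//]]].
  have : v * bary i x = bary (i + 2) x by rewrite mulfVK// gt_eqF.
  by rewrite E => <-; rewrite /vbreak; field; rewrite gt_eqF// P_gt0.
have ux : 0 <= u < ubreak P i m m.
  rewrite divr_ge0 ?x0//= lt_neqAle uX//= ler_pdivrMr// ge_break ?P_gt0//.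
have vy : v < vbreak P i m m.
  by rewrite lt_neqAle vY//= ler_pdivrMr// ge_break ?P_gt0.
have [l ln /andP[ul lu]] := slab_cover P_gt0 mn ux.
have vl : base_height P n i m l <= v.
  have [E|[q [qn bq uq ->]]] := base_height_attained P n i m l.
    by rewrite E divr_ge0.
  have [|[uq' _]] := blocksP mn l qn bq; first by rewrite leNgt uq.
  have bU : bary (i + 1) x * P q (i + 1) < bary i x * P m i.
    have := lt_le_trans lu uq'; rewrite ltr_pdivrMr//.
    by rewrite ltNge le_break ?P_gt0// -ltNge.
  have [ge gt] := Hm q qn; have [c Hc] := max_coord q x.
  have gq := gE _ _ Hc; rewrite gm gq in ge gt.
  rewrite ler_pdivlMr// le_break ?P_gt0//.
  (* The largest coordinate c of q is not i, because q blocks the first minimizer m, nor i + 1, by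
     [bU]. It is i + 2, and minimality of m puts v at or above the height of q. *)
  have [E|E|E] := ord3_cases i c; rewrite E in ge gt => //.
    case/orP: bq => [lt|/andP[/eqP eq qm]].
      by move: ge; rewrite ler_pM2l// leNgt lt.
    by move: (gt qm); rewrite eq ltxx.
  by move: ge; rewrite leNgt bU.
exists (i, m, l).
  by rewrite mem_triples mn ln /emits (le_lt_trans ul lu) (le_lt_trans vl vy).
split; first by rewrite -ler_pdivlMr.
- by rewrite -ler_pdivrMr// ltW.
- by rewrite -ler_pdivlMr.
- by rewrite -ler_pdivrMr// ltW.
Qed.

End Cells.

(** * Uniqueness of the cell off the exceptional lines *)

Section Uniqueness.
Variables (R : realType) (P : nat -> 'I_3 -> R) (n : nat).
Hypothesis P_gt0 : forall m c, (m < n)%N -> 0 < P m c.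
Implicit Types (i c : 'I_3) (m l q : nat) (x : R * R) (t : 'I_3 * nat * nat).

Lemma ord3_neq i : (i + 1 != i) && (i + 2 != i).
Proof. by case: i => -[|[|[|//]]]. Qed.

(** In weights the line u = [ubreak P i m q] reads w_j q_j = w_i m_i, which is exceptional; every
    slab end is such a break. *)
Lemma degenerate_on_ubreak i m q x : (m < n)%N -> (q < n)%N ->
  bary (i + 1) x = ubreak P i m q * bary i x -> degenerate P n x.
Proof.
move=> mn qn E; exists q, m, (i + 1), i; split=> //; first by case/andP: (ord3_neq i).
by rewrite E /ubreak; field; rewrite gt_eqF// P_gt0.
Qed.

Lemma degenerate_on_vbreak i m q x : (m < n)%N -> (q < n)%N ->
  bary (i + 2) x = vbreak P i m q * bary i x -> degenerate P n x.
Proof.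
move=> mn qn E; exists q, m, (i + 2), i; split=> //; first by case/andP: (ord3_neq i).
by rewrite E /vbreak; field; rewrite gt_eqF// P_gt0.
Qed.

(** Reconciles closed cells, wanted for polygons, with half-open ones, wanted for the integral. *)
Lemma cell_half_open i m l x : (m < n)%N -> emits P n (i, m, l) ->
  in_cell P n (i, m, l) x -> ~ degenerate P n x ->
  bary (i + 1) x < slab P n i m l.+1 * bary i x /\
  bary (i + 2) x < vbreak P i m m * bary i x.
Proof.
move=> mn em [_ h2 _ h4] nd; have [q qn E] := slab_break P i mn l.
split; rewrite lt_neqAle ?h2 ?h4 andbT; apply/eqP => E'; apply: nd.
  by apply: (@degenerate_on_ubreak i m q) => //; rewrite -E.
exact: (@degenerate_on_vbreak i m m).
Qed.

(** The earlier of two points at equal level blocks the later one. The cell of [m'] therefore avoids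
    the open quadrant of m while the cell of m lies in the closed one, so they meet only on a
    break. *)
Lemma earlier_point i m m' l l' x : (m < m' < n)%N -> P m i = P m' i ->
  emits P n (i, m, l) -> in_cell P n (i, m, l) x ->
  emits P n (i, m', l') -> in_cell P n (i, m', l') x -> degenerate P n x.
Proof.
move=> /andP[mm' mn'] E em cm em' cm'; have mn := ltn_trans mm' mn'.
have [H _] := cell_active P_gt0 mn em cm.
have [u0 u12 v0 v12] := emits_quad P_gt0 mn' em'.
have b0 := in_quad_gt0 u12 cm'; case: cm' => h1 _ h3 _.
have b : blocks P i m' m by rewrite /blocks E eqxx mm' orbT.
have [h|[_ h]] := blocksP mn' l' mn b.
  apply: (@degenerate_on_ubreak i m m) => //; apply/eqP; rewrite eq_le.
  rewrite ge_break ?P_gt0// H /= /ubreak E -/(ubreak P i m' m).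
  by apply: le_trans h1; rewrite ler_wpM2r// ltW.
apply: (@degenerate_on_vbreak i m m) => //; apply/eqP; rewrite eq_le.
rewrite ge_break ?P_gt0// H /= /vbreak E -/(vbreak P i m' m).
by apply: le_trans h3; rewrite ler_wpM2r// ltW.
Qed.

Lemma earlier_slab i m l l' x : (m < n)%N -> (l < l')%N -> emits P n (i, m, l) ->
  in_cell P n (i, m, l) x -> in_cell P n (i, m, l') x -> degenerate P n x.
Proof.
move=> mn ll' em cm [h1 _ _ _].
have [u0 u12 v0 v12] := emits_quad P_gt0 mn em.
have b0 := in_quad_gt0 u12 cm; case: cm => _ h2 _ _.
have [q qn E] := slab_break P i mn l.
apply: (@degenerate_on_ubreak i m q) => //; rewrite -E; apply/eqP; rewrite eq_le h2 /=.
by apply: le_trans h1; rewrite ler_wpM2r ?(ltW b0)//; exact: (slab_homo P_gt0 _ mn ll').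
Qed.

(** Both cells give the same envelope value at x. Distinct active coordinates then form an equation
    of [degenerate]; with a common one, [bary i x > 0] forces equal levels, leaving only ties and
    distinct slabs of one point. *)
Lemma cells_unique t t' x : t \in triples n -> emits P n t -> in_cell P n t x ->
  t' \in triples n -> emits P n t' -> in_cell P n t' x ->
  ~ degenerate P n x -> t = t'.
Proof.
case: t t' => [[i m] l] [[i' m'] l'].
rewrite !mem_triples => /andP[mn ln] et ct /andP[mn' ln'] et' ct' nd.
have [A1 A2] := cell_active P_gt0 mn et ct; have [B1 B2] := cell_active P_gt0 mn' et' ct'.
have E : bary i x * P m i = bary i' x * P m' i'.
  apply/eqP; rewrite eq_le; apply/andP; split.
    by have [c h] := A2 _ mn'; exact: le_trans h (B1 c).
  by have [c h] := B2 _ mn; exact: le_trans h (A1 c).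
have [ii|/eqP ii] := eqVneq i i'; last by case: nd; exists m, m', i, i'; split=> //; apply/eqP.
subst i'.
have [u0 u12 v0 v12] := emits_quad P_gt0 mn et.
have b0 := in_quad_gt0 u12 ct.
have {}E : P m i = P m' i by apply: (mulfI (lt0r_neq0 b0)).
have [mm|mm|mm] := ltngtP m m'.
- by case: nd; apply: (@earlier_point i m m' l l') => //; rewrite mm.
- by case: nd; apply: (@earlier_point i m' m l' l) => //; rewrite mm.
subst m'; have [ll|ll|->//] := ltngtP l l'.
- by case: nd; exact: (@earlier_slab i m l l').
- by case: nd; exact: (@earlier_slab i m l' l).
Qed.

End Uniqueness.

Section Tau.
Variable R : realType.
Implicit Types (s : seq 'rV[R]_3) (p w : 'rV[R]_3) (i : 'I_3).

Lemma cheby_ge p w i : w 0 i * p 0 i <= cheby p w.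
Proof. exact: le_bigmax_cond. Qed.

Lemma cheby_max p w i : (forall c, w 0 c * p 0 c <= w 0 i * p 0 i) ->
  cheby p w = w 0 i * p 0 i.
Proof.
by move=> H; apply/eqP; rewrite eq_le cheby_ge andbT; apply: bigmax_le.
Qed.

Lemma tau_active s m i (x : R * R) : (m < size s)%N ->
  active (fun q c => (nth 0 s q) 0 c) (size s) i m x ->
  tau s (chart x) = bary i x * (nth 0 s m) 0 i.
Proof.
move=> ms [H1 H2]; rewrite -(@cheby_max (nth 0 s m) (chart x) i)//.
set g := fun p => cheby p (chart x).
have gle p : p \in s -> g (nth 0 s m) <= g p.
  move=> ps; rewrite -(nth_index 0 ps) /g (@cheby_max _ _ i)//.
  have [|c h] := H2 (index p s); first by rewrite index_mem.
  exact: le_trans h (cheby_ge _ _ _).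
apply/eqP; rewrite eq_le /tau; apply/andP; split.
  exact: (@bigmin_inf_seq _ _ _ _ _ (nth 0 s m) xpredT _ _ (mem_nth 0 ms)).
rewrite big_seq; apply: (big_ind (fun y => g (nth 0 s m) <= y)) => //.
(* The seed of the minimum is the value at the head, itself a member of the nonempty list. *)
- by apply: gle; case: {+}s ms => //= p s' _; rewrite mem_head.
- by move=> y z hy hz; rewrite le_min hy.
Qed.

End Tau.

(** * From rational to real arithmetic *)

Section Transport.
Variables (R : realType) (P : nat -> 'I_3 -> rat) (n : nat).
Let PR m c : R := ratr (P m c).
Implicit Types (i c : 'I_3) (m l q : nat) (t : 'I_3 * nat * nat) (u v : rat).

Lemma ratr_ubreak i m q : ubreak PR i m q = ratr (ubreak P i m q).
Proof. by rewrite /ubreak fmorph_div. Qed.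

Lemma ratr_vbreak i m q : vbreak PR i m q = ratr (vbreak P i m q).
Proof. by rewrite /vbreak fmorph_div. Qed.

Lemma ratr_min u v : ratr (Num.min u v) = Num.min (ratr u) (ratr v) :> R.
Proof. by rewrite /Order.min ltr_rat; case: ifP. Qed.

Lemma ratr_max u v : ratr (Num.max u v) = Num.max (ratr u) (ratr v) :> R.
Proof. by rewrite /Order.max ltr_rat; case: ifP. Qed.

Lemma ratr_blocks i m q : blocks PR i m q = blocks P i m q.
Proof. by rewrite /blocks /PR ltr_rat (inj_eq (fmorph_inj _)). Qed.

Lemma ratr_sweep r i m u : sweep PR r i m (ratr u) =
  (ratr (sweep P r i m u).1, ratr (sweep P r i m u).2).
Proof.
rewrite /sweep; elim: r => [|r IH]; first by rewrite /= ratr_ubreak rmorph0.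
rewrite -[r.+1]addn1 iotaD !foldl_cat IH /= /sweep_step ratr_blocks ratr_ubreak ltr_rat.
by case: ifP => //= _; rewrite ratr_vbreak ratr_min ratr_max.
Qed.

Lemma ratr_slab i m l : slab PR n i m l = ratr (slab P n i m l).
Proof.
by elim: l => [|l IH]; rewrite /slab ?rmorph0// !iterS -!/(slab _ _ _ _ _) IH ratr_sweep.
Qed.

Lemma ratr_base_height i m l : base_height PR n i m l = ratr (base_height P n i m l).
Proof. by rewrite /base_height ratr_slab ratr_sweep. Qed.

Lemma ratr_emits t : emits PR n t = emits P n t.
Proof.
by case: t => [[i m] l]; rewrite /emits !ratr_slab ratr_base_height ratr_vbreak !ltr_rat.
Qed.

Lemma ratr_pt i u v : pt i (ratr u) (ratr v) = (ratr (pt i u v).1, ratr (pt i u v).2) :> R * R.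
Proof.
by case: i => -[|[|[|//]]] ?;
  rewrite /pt /= !(rmorphM, fmorphV, rmorphD, rmorph1).
Qed.

Lemma ratr_cell_quad t : cell_quad PR n t =
  [seq (ratr z.1, ratr z.2) | z <- cell_quad P n t].
Proof.
case: t => [[i m] l].
by rewrite /cell_quad /quad !ratr_slab ratr_base_height ratr_vbreak !ratr_pt.
Qed.

Lemma ratr_cell_val t : cell_val PR n t = ratr (cell_val P n t).
Proof.
case: t => [[i m] l]; rewrite /cell_val /quad_val !ratr_slab ratr_base_height ratr_vbreak.
have C a u v : ratr (corner a u v) = corner (ratr a) (ratr u) (ratr v) :> R.
  by rewrite /corner !(fmorph_div, rmorphM, rmorphD, rmorph1, rmorph_nat).
by rewrite -!C -rmorphB -rmorphD -rmorphB.
Qed.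

End Transport.

(** * The subdivision *)

Local Open Scope classical_set_scope.
Local Open Scope ring_scope.

Section Subdivision.
Variables (R : realType) (P : nat -> 'I_3 -> R) (n : nat).
Hypothesis P_gt0 : forall m c, (m < n)%N -> 0 < P m c.
Implicit Types (c : 'I_3) (m q : nat) (x : R * R).

Lemma ge0_bary_chart x : (@chart R @^-1` (@Delta2 R)) x <-> forall c, 0 <= bary c x.
Proof.
split=> [[]//|h]; split=> //.
by rewrite !big_ord_recl big_ord0 !mxE /=; ring.
Qed.

Definition bary_const c (x1 : R) : R := [:: x1; 0; 1 - x1]`_c.
Definition bary_slope c : R := [:: 0; 1; -1]`_c.

Lemma bary_affine c x : bary c x = bary_const c x.1 + bary_slope c * x.2.
Proof. by case: c => -[|[|[|//]]] ?; rewrite /bary mxE /bary_const /bary_slope /=; ring. Qed.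

(** On a vertical line the weights are affine with slopes 0, 1, -1. Positive factors keep two
    distinct slopes distinct, so each exceptional line meets the vertical line in one point. *)
Lemma finite_degenerate (x1 : R) : finite_set [set y | degenerate P n (x1, y)].
Proof.
pose sol (a : nat * 'I_3 * (nat * 'I_3)) : R :=
  let: ((m, c), (q, c')) := a in
  (bary_const c' x1 * P q c' - bary_const c x1 * P m c) /
  (bary_slope c * P m c - bary_slope c' * P q c').
pose pts := [seq (m, c) | m <- iota 0 n, c <- enum 'I_3].
apply: (@sub_finite_set _ _ [set` [seq sol (a, b) | a <- pts, b <- pts]]); last exact: finite_seq.
move=> y [m [q [c [c' [mn qn cc E]]]]] /=.
apply/allpairsP; exists ((m, c), (q, c')); split.
- by apply/allpairsP; exists (m, c); rewrite mem_iota mem_enum.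
- by apply/allpairsP; exists (q, c'); rewrite mem_iota mem_enum.
have p0 := P_gt0 c mn; have q0 := P_gt0 c' qn.
move: E; rewrite !bary_affine /= => E.
have s0 : bary_slope c * P m c - bary_slope c' * P q c' != 0.
  case: c c' cc p0 q0 {E} => -[|[|[|//]]] hc [[|[|[|//]]] hc'] // _ p0 q0;
    rewrite /bary_slope /=; lra.
by apply: (mulIf s0); rewrite mulfVK //; lra.
Qed.

(** Close to y the segment contains an open interval of positive length, whereas a finite set is
    null. *)
Lemma finite_avoid (B : set R) (a b y : R) (U : set R) : finite_set B -> a < b ->
  a <= y <= b -> nbhs y U -> exists z, [/\ a <= z <= b, U z & ~ B z].
Proof.
move=> Bfin ab /andP[ay yb] /nbhs_ballP[e /= e0 He].
pose lo := Num.max a (y - e); pose hi := Num.min b (y + e).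
have lohi : lo < hi.
  by rewrite lt_min !gt_max ab /=; apply/and3P; split; [lra|lra|lra].
apply: contrapT => /forallNP H.
have sub : `]lo, hi[ `<=` B.
  move=> z /=; rewrite in_itv /= gt_max lt_min => /andP[/andP[az yz] /andP[zb zy]].
  apply: contrapT => Bz; apply: (H z); split=> //; first by rewrite !ltW.
  by apply: He; rewrite /ball /= ltr_norml; apply/andP; split; lra.
have := @countable_lebesgue_measure0 R `]lo, hi[
  (sub_countable (subset_card_le sub) (finite_set_countable Bfin)).
rewrite lebesgue_measure_itv /= lte_fin lohi -EFinD => -[]; lra.
Qed.

Lemma nbhs_nondegenerate x (U : set (R * R)) (a b : R) : a < b -> a <= x.2 <= b ->
  nbhs x U -> exists y, [/\ a <= y <= b, U (x.1, y) & ~ degenerate P n (x.1, y)].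
Proof.
move=> ab ax Ux; apply: (finite_avoid (finite_degenerate x.1) ab ax).
have H : (fun y : R => (x.1, y)) @ nbhs x.2 --> (x.1, x.2).
  by apply: (@cvg_pair _ _ _ _ (nbhs x.1) (nbhs x.2)); [exact: cvg_cst|exact: cvg_id].
by apply: H; rewrite -surjective_pairing.
Qed.

Lemma orient_continuous (u v : R * R) : continuous (orient u v : R * R -> R).
Proof.
move=> x; rewrite /orient; apply: cvgB; (apply: cvgM; first exact: cvg_cst).
  by apply: cvgB; [exact: cvg_snd|exact: cvg_cst].
by apply: cvgB; [exact: cvg_fst|exact: cvg_cst].
Qed.

Lemma polygon_region_closed (vs : seq (R * R)) : closed (polygon_region vs).
Proof.
have -> : polygon_region vs =
    \bigcap_(e in [set` edges vs]) (orient e.1 e.2 @^-1` [set r : R | 0 <= r]).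
  by apply/seteqP; split=> x.
apply: closed_bigI => e _; apply: closed_comp; last exact: closed_ge.
by move=> x _; exact: orient_continuous.
Qed.

Let ts := [seq t <- triples n | emits P n t].
Let cells := [seq cell_quad P n t | t <- ts].

Lemma cell_regionP t : t \in ts -> polygon_region (cell_quad P n t) = in_cell P n t.
Proof.
case: t => [[i m] l]; rewrite mem_filter mem_triples => /and3P[em mn ln].
have [? ? ? ?] := emits_quad P_gt0 mn em.
by apply/seteqP; split=> x /=; [move/quad_regionP; apply|move=> ?; apply/quad_regionP].
Qed.

Lemma cell_convex t : t \in ts -> convex_polygon (cell_quad P n t).
Proof.
case: t => [[i m] l]; rewrite mem_filter mem_triples => /and3P[em mn ln].
by have [? ? ? ?] := emits_quad P_gt0 mn em; exact: quad_convex.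
Qed.

Lemma in_cell_ge0 t x c : t \in ts -> in_cell P n t x -> 0 <= bary c x.
Proof.
case: t => [[i m] l]; rewrite mem_filter mem_triples => /and3P[em mn ln].
by have [? ? ? ?] := emits_quad P_gt0 mn em; exact: in_quad_ge0.
Qed.

Let covered : set (R * R) := \bigcup_(vs in [set` cells]) polygon_region vs.

Lemma covered_closed : closed covered.
Proof. by apply: closed_bigcup => [|vs _]; [exact: finite_seq|exact: polygon_region_closed]. Qed.

Lemma bary_ge0 x : (forall c, 0 <= bary c x) <-> [/\ 0 <= x.1, 0 <= x.2 & x.2 <= 1 - x.1].
Proof.
split=> [h|[h1 h2 h3] c].
  have := (h 0, h 1, h 2); rewrite /bary !mxE /= => -[[h0 h1] h2].
  by split=> //; rewrite -subr_ge0.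
by case: c => -[|[|[|//]]] ?; rewrite /bary mxE //= subr_ge0.
Qed.

Lemma nondegenerate_covered x : (0 < n)%N -> (forall c, 0 <= bary c x) ->
  ~ degenerate P n x -> covered x.
Proof.
move=> n0 x0 nd; have [t tP tx] := cells_cover P_gt0 n0 x0 nd.
have tts : t \in ts by rewrite mem_filter andbC.
by exists (cell_quad P n t); [exact: map_f|rewrite cell_regionP].
Qed.

(** The union of the cells is closed and contains the nondegenerate weights, so it suffices to
    approach x by such weights along its vertical section of the triangle. *)
Lemma Delta2_covered x : (0 < n)%N -> (forall c, 0 <= bary c x) -> covered x.
Proof.
move=> n0 /bary_ge0[x10 x20 x21].
have cov x' : x'.1 < 1 -> [/\ 0 <= x'.1, 0 <= x'.2 & x'.2 <= 1 - x'.1] -> covered x'.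
  move=> x1 [h1 h2 h3]; apply: covered_closed => U Ux.
  have [||y [/andP[y0 y1] Uy nd]] := @nbhs_nondegenerate x' U 0 (1 - x'.1) _ _ Ux.
  - by rewrite subr_gt0.
  - by rewrite h2.
  exists (x'.1, y); split=> //; apply: nondegenerate_covered => //.
  exact/bary_ge0.
have [x1|x1] := ltP x.1 1; first exact: cov.
(* At this vertex the vertical section is a single, degenerate point; the approach is along the edge
   [x.2 = 0], through points covered by [cov]. *)
have -> : x = (1, 0) by rewrite [x]surjective_pairing; congr (_, _); lra.
apply: covered_closed => U U1.
have : nbhs (1 : R) [set t : R | U (t, 0)].
  have H : (fun t : R => (t, 0 : R)) @ nbhs (1 : R) --> (1 : R, 0 : R).
    by apply: (@cvg_pair _ _ _ _ (nbhs (1 : R)) (nbhs (0 : R)));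
      [exact: cvg_id|exact: cvg_cst].
  exact: H.
move=> /(finite_avoid (finite_set1 (1 : R)) (ltr01)) [|t [/andP[t0 t1] Ut nt]].
  by rewrite ler01 lexx.
exists (t, 0); split=> //; apply: cov; last by split; rewrite /= ?subr_ge0.
by rewrite lt_neqAle t1 andbT; apply/eqP.
Qed.

Lemma cells_subdivision : (0 < n)%N -> planar_subdivision (@chart R @^-1` (@Delta2 R)) cells.
Proof.
move=> n0; split.
- by move=> vs /mapP[t tts ->]; exact: cell_convex.
- apply/seteqP; split=> x.
    move=> [vs /mapP[t tts ->]]; rewrite cell_regionP// => tx.
    by apply/ge0_bary_chart => c; exact: in_cell_ge0 tx.
  by move=> /ge0_bary_chart; exact: Delta2_covered.
move=> j k /andP[jk ks]; rewrite size_map in ks; have js := ltn_trans jk ks.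
pose t0 : 'I_3 * nat * nat := (0, 0%N, 0%N).
rewrite !(nth_map t0)//; set t := nth t0 ts j; set t' := nth t0 ts k.
have tts : t \in ts by exact: mem_nth.
have t'ts : t' \in ts by exact: mem_nth.
rewrite -subset0 => x [+ +]; rewrite !cell_regionP// => tx t'x.
(* The interval is a mere window around [x.2]; the constraint comes from the open intersection. *)
have := @nbhs_nondegenerate x (in_cell P n t `&` in_cell P n t') (x.2 - 1) (x.2 + 1).
case=> [|||y [_ [yt yt'] nd]]; [lra|by apply/andP; split; lra|exact: filterI|].
have : t = t'.
  move: tts t'ts; rewrite !mem_filter => /andP[et it] /andP[et' it'].
  exact: (cells_unique P_gt0 it et yt it' et' yt').
move=> /eqP; rewrite nth_uniq ?filter_uniq ?triples_uniq// => /eqP E.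
by rewrite E ltnn in jk.
Qed.

End Subdivision.

(** * The integral *)

Section Corner.
Variable R : realType.
Let T := measurableTypeR R.
Let la := @lebesgue_measure R.
Let mu := (la \x la)%E.

Lemma lebesgue_measure_reflect (c : R) (A : set R) : measurable A ->
  pushforward la (fun y : T => c - y : T) A = la A.
Proof.
move=> mA; apply/esym/lebesgue_measure_unique => //=; first exact: measurable_funB.
move=> _ _ [[a b]] _ <-.
rewrite /pushforward (_ : _ @^-1` _ = `[c - b, c - a[%classic).
  rewrite !lebesgue_measure_itv/= !lte_fin ltrD2l ltrN2.
  by case: ifP => // _; congr (_%:E); ring.
by apply/seteqP; split=> y /=; rewrite !in_itv /= => /andP[h1 h2]; apply/andP; split; lra.
Qed.

Lemma integral_reflect (c : R) (f : T -> \bar R) :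
  measurable_fun setT f -> (forall y, 0 <= f y)%E ->
  (\int[la]_y f (c - y)%R = \int[la]_y f y)%E.
Proof.
move=> mf f0.
have mc : measurable_fun setT (fun y : T => c - y : T) by exact: measurable_funB.
pose phi (y : T) : T := c - y.
rewrite -[LHS]/(\int[la]_(y in phi @^-1` setT) (f \o phi) y)%E.
rewrite -ge0_integral_pushforward//.
by apply: eq_measure_integral => A mA _; exact: lebesgue_measure_reflect.
Qed.

(** With t = w_i and s = w_j, this is w_i on the region u >= al, v >= be; the last test says w_k = 1
    - t - s >= be t. *)
Definition strip (al be : R) (x : T * T) : R :=
  if [&& 0 <= x.1, al * x.1 <= x.2 & x.2 <= 1 - x.1 - be * x.1] then x.1 else 0.

Lemma strip_ge0 al be x : 0 <= strip al be x.
Proof. by rewrite /strip; case: ifP => // /and3P[]. Qed.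

Lemma measurable_strip al be : measurable_fun setT (strip al be).
Proof.
have m1 : measurable_fun setT (fun x : T * T => x.1) by exact: measurable_fst.
have m2 : measurable_fun setT (fun x : T * T => x.2) by exact: measurable_snd.
apply: measurable_fun_ifT => //.
apply: measurable_and; first exact: measurable_fun_ler.
apply: measurable_and; apply: measurable_fun_ler => //.
  exact: measurable_funM.
by apply: measurable_funB; [exact: measurable_funB|exact: measurable_funM].
Qed.

Section Value.
Variables (al be : R).
Hypotheses (al0 : 0 <= al) (be0 : 0 <= be).
Let A := 1 + al + be.
Let A0 : 0 < A. Proof. by rewrite /A; move: al0 be0; lra. Qed.

(** The section at t is a segment of length 1 - A t, empty beyond 1 / A. *)
Lemma integral_strip_section (t : R) :
  (\int[la]_s (strip al be (t, s))%:E =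
   ((fun t : R => (t * (1 - A * t))%R%:E) \_ `[0%R, A^-1%R]) t)%E.
Proof.
rewrite patchE.
have [t0|t0] := ltP t 0.
  rewrite memNset; last by rewrite /= in_itv /= leNgt t0.
  by under eq_integral do rewrite /strip /= leNgt t0 /=; rewrite integral0.
transitivity (\int[la]_(s in `[(al * t)%R, (1 - t - be * t)%R]) (cst t%:E s))%E.
  rewrite [RHS]integral_mkcond; apply: eq_integral => s _; rewrite patchE /strip /= t0 /=.
  by case: ifPn => h; [rewrite mem_set|rewrite memNset //=; apply/negP].
rewrite integral_cst//= lebesgue_measure_itv/= lte_fin.
have -> : (al * t < 1 - t - be * t) = (t < A^-1).
  rewrite -[A^-1]mul1r ltr_pdivlMr// /A; apply/idP/idP; lra.
have [tA|tA] := ltP t A^-1.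
  rewrite mem_set; last by rewrite /= in_itv /= t0 ltW.
  by rewrite -EFinD -EFinM; congr (_%:E); rewrite /A; ring.
rewrite mule0; case: ifP => // /set_mem; rewrite /= in_itv /= t0 /= => tA'.
have -> : t = A^-1 by apply/eqP; rewrite eq_le tA tA'.
by rewrite mulfV ?gt_eqF// subrr mulr0.
Qed.

Lemma integral_parabola :
  (\int[la]_(t in `[0%R, A^-1%R]) (t * (1 - A * t))%R%:E = (1 / 6 / A ^+ 2)%R%:E)%E.
Proof.
pose F (x : R) : R := x ^+ 2 / 2 - A * x ^+ 3 / 3.
have dF (t : R) : is_derive t 1 F (t * (1 - A * t)).
  by rewrite /F; apply: is_derive_eq; rewrite /GRing.scale /=; field.
have cF : continuous F.
  by move=> t; apply: differentiable_continuous; apply/derivable1_diffP; exact: ex_derive.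
have Ai : 0 < A^-1 by rewrite invr_gt0.
have cf : {within `[0, A^-1], continuous (fun t : R => t * (1 - A * t))}.
  apply: continuous_subspaceT => t; apply: cvgM; first exact: cvg_id.
  by apply: cvgB; [exact: cvg_cst|apply: cvgM; [exact: cvg_cst|exact: cvg_id]].
have oo : derivable_oo_LRcontinuous F 0 A^-1.
  split; first by move=> t _; exact: ex_derive.
  - exact/cvg_at_right_filter/cF.
  - exact/cvg_at_left_filter/cF.
apply: etrans (continuous_FTC2 Ai cf oo _) _.
  by move=> t _; rewrite derive1E; exact: derive_val.
rewrite /F -EFinD; congr (_%:E); field; exact: lt0r_neq0.
Qed.

Lemma iterated_strip :
  (\int[la]_t \int[la]_s (strip al be (t, s))%:E = (1 / 6 / A ^+ 2)%R%:E)%E.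
Proof.
by under eq_integral do rewrite integral_strip_section; rewrite -integral_mkcond integral_parabola.
Qed.

End Value.

Definition corner_fun (i : 'I_3) (al be : R) (x : T * T) : R :=
  if [&& 0 <= bary i x, al * bary i x <= bary (i + 1) x & be * bary i x <= bary (i + 2) x]
  then bary i x else 0.

Lemma measurable_bary (c : 'I_3) : measurable_fun setT (fun x : T * T => bary c x).
Proof.
rewrite (_ : (fun _ => _) = fun x : T * T => bary_const c x.1 + bary_slope R c * x.2); last first.
  by apply/funext => x; exact: bary_affine.
apply: measurable_funD; last by apply: measurable_funM => //; exact: measurable_snd.
case: c => -[|[|[|//]]] hc; rewrite /bary_const /=.
- exact: measurable_fst.
- exact: measurable_cst.
- by apply: measurable_funB => //; exact: measurable_fst.
Qed.

Lemma corner_fun_ge0 i al be x : 0 <= corner_fun i al be x.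
Proof. by rewrite /corner_fun; case: ifP => // /and3P[]. Qed.

Lemma measurable_corner_fun i al be : measurable_fun setT (corner_fun i al be).
Proof.
apply: measurable_fun_ifT => //; last exact: measurable_bary.
apply: measurable_and; first by apply: measurable_fun_ler => //; exact: measurable_bary.
by apply: measurable_and; apply: measurable_fun_ler => //; try exact: measurable_bary;
  apply: measurable_funM => //; exact: measurable_bary.
Qed.

Lemma corner_fun0 al be x : corner_fun 0 al be x = strip al be x.
Proof.
rewrite /corner_fun /strip /bary !mxE /=.
by congr (if [&& _, _ & _] then _ else _); apply/idP/idP; lra.
Qed.

Lemma corner_fun1 al be (x1 x2 : T) : corner_fun 1 al be (x1, x2) = strip be al (x2, x1).
Proof.
rewrite /corner_fun /strip /bary !mxE /= [X in _ && X]andbC.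
by congr (if [&& _, _ & _] then _ else _); apply/idP/idP; lra.
Qed.

Lemma corner_fun2 al be (x1 x2 : T) :
  corner_fun 2 al be (x1, x2) = strip al be (1 - x1 - x2, x1).
Proof.
rewrite /corner_fun /strip /bary !mxE /=.
by congr (if [&& _, _ & _] then _ else _); apply/idP/idP; lra.
Qed.

(* The region is the triangle on the edge opposite to the vertex i with apex
   (1, al, be) / (1 + al + be); lines parallel to that edge slice it. *)
Lemma integral_corner_fun i al be : 0 <= al -> 0 <= be ->
  (\int[mu]_x (corner_fun i al be x)%:E = (1 / 6 / (1 + al + be) ^+ 2)%R%:E)%E.
Proof.
move=> al0 be0.
have mS a b : measurable_fun setT (fun x : T * T => (strip a b x)%:E).
  by apply/measurable_EFinP; exact: measurable_strip.
have S0 a b x : (0 <= (strip a b x)%:E)%E by rewrite lee_fin strip_ge0.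
have mC : measurable_fun setT (fun x : T * T => (corner_fun i al be x)%:E).
  by apply/measurable_EFinP; exact: measurable_corner_fun.
have C0 x : (0 <= (corner_fun i al be x)%:E)%E by rewrite lee_fin corner_fun_ge0.
case: (ord3_cases 0 i) => E; rewrite {i}E ?add0r in mC C0 *.
- under eq_integral do rewrite corner_fun0.
  by rewrite fubini_tonelli1// iterated_strip.
- rewrite fubini_tonelli2// /fubini_G.
  under eq_integral do under eq_integral do rewrite corner_fun1.
  by rewrite iterated_strip//; congr ((_ / _ ^+ _)%:E); ring.
- rewrite fubini_tonelli1// /fubini_F.
  (* For fixed [x1], t = 1 - x1 - x2 is a reflection of [x2] and preserves the measure; Tonelli then
     exchanges t and [x1]. *)
  transitivity (\int[la]_x1 \int[la]_t (strip al be (t, x1))%:E)%E.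
    apply: eq_integral => x1 _.
    under eq_integral do rewrite corner_fun2.
    apply: (integral_reflect (1 - x1) (f := fun t => (strip al be (t, x1))%:E)) => //.
    by apply: (measurableT_comp (mS al be)); exact: measurable_pair2.
  have := fubini_tonelli2 (m1 := lebesgue_measure) (m2 := lebesgue_measure) _ (mS al be) (S0 al be).
  rewrite /fubini_G => <-.
  by rewrite fubini_tonelli1// iterated_strip.
Qed.

End Corner.

Section Integral.
Variable R : realType.
Let T := measurableTypeR R.
Let la := @lebesgue_measure R.
Let mu := (la \x la)%E.

(** Half-open, unlike [in_quad], so that inclusion-exclusion over the corners is an exact pointwise
    identity. *)
Definition quad_fun (i : 'I_3) (u1 u2 v1 v2 : R) (x : T * T) : R :=
  if [&& u1 * bary i x <= bary (i + 1) x, bary (i + 1) x < u2 * bary i x,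
         v1 * bary i x <= bary (i + 2) x & bary (i + 2) x < v2 * bary i x]
  then bary i x else 0.

Lemma measurable_quad_fun i u1 u2 v1 v2 : measurable_fun setT (quad_fun i u1 u2 v1 v2).
Proof.
have mb c := @measurable_bary R c.
have mM a c : measurable_fun setT (fun x : T * T => a * bary c x).
  exact: measurable_funM.
apply: measurable_fun_ifT => //.
apply: measurable_and; first exact: measurable_fun_ler.
apply: measurable_and; first exact: measurable_fun_ltr.
apply: measurable_and; first exact: measurable_fun_ler.
exact: measurable_fun_ltr.
Qed.

Section Quad.
Variables (i : 'I_3) (u1 u2 v1 v2 : R).
Hypotheses (u10 : 0 <= u1) (u12 : u1 < u2) (v10 : 0 <= v1) (v12 : v1 < v2).
Let q := quad_fun i u1 u2 v1 v2.

Lemma quad_fun_ge0 x : 0 <= q x.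
Proof.
rewrite /q /quad_fun; case: ifP => // /and4P[h1 h2 _ _]; rewrite leNgt; apply/negP => b0.
have : (u2 - u1) * bary i x < 0 by rewrite pmulr_rlt0 ?subr_gt0.
by rewrite mulrBl subr_lt0 ltNge (le_trans h1 (ltW h2)).
Qed.

(** A product of two differences of half-line indicators, with negative terms moved across so that
    only sums of nonnegative functions are integrated. *)
Lemma quad_fun_corners x :
  q x + corner_fun i u2 v1 x + corner_fun i u1 v2 x =
  corner_fun i u1 v1 x + corner_fun i u2 v2 x.
Proof.
rewrite /q /quad_fun /corner_fun; set b := bary i x.
set bj := bary (i + 1) x; set bk := bary (i + 2) x.
have [b0|b0] := leP 0 b; last first.
  rewrite /= !addr0; case: ifP => // /and4P[h1 h2 _ _].
  have : (u2 - u1) * b < 0 by rewrite pmulr_rlt0 ?subr_gt0.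
  by rewrite mulrBl subr_lt0 ltNge (le_trans h1 (ltW h2)).
have uu : u1 * b <= u2 * b by rewrite ler_wpM2r// ltW.
have vv : v1 * b <= v2 * b by rewrite ler_wpM2r// ltW.
rewrite /=; have [h1|h1] := leP (u1 * b) bj; last first.
  by rewrite [u2 * b <= bj]leNgt (lt_le_trans h1 uu) /= !addr0.
have [h3|h3] := leP (v1 * b) bk; last first.
  by rewrite [v2 * b <= bk]leNgt (lt_le_trans h3 vv) /= !andbF !addr0.
have [h2|h2] := leP (u2 * b) bj; have [h4|h4] := leP (v2 * b) bk => /=; lra.
Qed.

Lemma integral_quad_fun : (\int[mu]_x (q x)%:E = (quad_val 1 u1 u2 v1 v2)%:E)%E.
Proof.
have mq : measurable_fun setT (fun x : T * T => (q x)%:E).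
  by apply/measurable_EFinP; exact: measurable_quad_fun.
have mc a b : measurable_fun setT (fun x : T * T => (corner_fun i a b x)%:E).
  by apply/measurable_EFinP; exact: measurable_corner_fun.
have q0 x : (0 <= (q x)%:E)%E by rewrite lee_fin quad_fun_ge0.
have c0 a b x : (0 <= (corner_fun i a b x)%:E)%E by rewrite lee_fin corner_fun_ge0.
have u20 : 0 <= u2 by rewrite (le_trans u10)// ltW.
have v20 : 0 <= v2 by rewrite (le_trans v10)// ltW.
have E : (\int[mu]_x (q x)%:E + (1 / 6 / (1 + u2 + v1) ^+ 2)%R%:E +
      (1 / 6 / (1 + u1 + v2) ^+ 2)%R%:E =
    (1 / 6 / (1 + u1 + v1) ^+ 2)%R%:E + (1 / 6 / (1 + u2 + v2) ^+ 2)%R%:E)%E.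
  rewrite -!(integral_corner_fun i)// -!ge0_integralD//; last 2 first.
  - by move=> x _; rewrite adde_ge0.
  - exact: emeasurable_funD.
  by apply: eq_integral => x _; rewrite -!EFinD quad_fun_corners.
have : (0 <= \int[mu]_x (q x)%:E)%E by apply: integral_ge0.
(* Nonnegativity excludes minus infinity and [E] excludes plus infinity, so the equation can be
   solved in the reals. *)
move: E; case: (\int[mu]_x _)%E => [r| |] //=; rewrite -!EFinD => -[E] _; congr (_%:E).
move: E; rewrite /quad_val /corner !mulr1 => E.
rewrite -[r](addrK (1 / 6 / (1 + u2 + v1) ^+ 2)).
rewrite -[r + _](addrK (1 / 6 / (1 + u1 + v2) ^+ 2)) E !div1r -!exprVn -!expr2.
by ring.
Qed.

End Quad.

Section R2.
Variable (s : seq 'rV[R]_3).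
Let P (m : nat) (c : 'I_3) : R := (nth 0 s m) 0 c.
Let n := size s.
Hypothesis n0 : (0 < n)%N.
Hypothesis P_gt0 : forall m c, (m < n)%N -> 0 < P m c.
Let N : set (T * T) := [set x | degenerate P n x].

Lemma measurable_degenerate : measurable N.
Proof.
pose pts := [seq (m, c) | m <- iota 0 n, c <- enum 'I_3].
pose pairs := [seq a <- [seq (a, b) | a <- pts, b <- pts] | a.1.2 != a.2.2].
pose gap (a : nat * 'I_3 * (nat * 'I_3)) (x : T * T) : R :=
  bary a.1.2 x * P a.1.1 a.1.2 - bary a.2.2 x * P a.2.1 a.2.2.
have ptsE a : (a \in pts) = (a.1 < n)%N.
  case: a => m c; apply/allpairsP/idP => [[[m1 c1] [+ _ [-> _]]]|mn].
    by rewrite mem_iota add0n => /andP[].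
  by exists (m, c); rewrite mem_iota mem_enum.
have pairsE a : (a \in pairs) = [&& a.1.2 != a.2.2, (a.1.1 < n)%N & (a.2.1 < n)%N].
  rewrite mem_filter -!ptsE; congr (_ && _); apply/allpairsP/andP => [[[b c] [h1 h2 ->]]|[h1 h2]].
    by split.
  by exists a; split=> //; case: a {h1 h2}.
have -> : N = \bigcup_(a in [set` pairs]) (gap a @^-1` [set 0]).
  apply/seteqP; split=> x.
    move=> [m [q [c [c' [mn qn cc E]]]]].
    exists ((m, c), (q, c')); first by rewrite /= pairsE /= cc mn.
    by rewrite /gap /= E subrr.
  move=> [[[m c] [q c']]]; rewrite /= pairsE /= => /and3P[cc mn qn].
  by rewrite /gap /= => /eqP; rewrite subr_eq0 => /eqP E; exists m, q, c, c'.
rewrite bigcup_seq; apply: bigsetU_measurable => a _.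
have mg : measurable_fun setT (gap a).
  by apply: measurable_funB; apply: measurable_funM => //; exact: measurable_bary.
by rewrite -[X in measurable X]setTI; exact: mg.
Qed.

(** The product measure integrates the measures of vertical sections, which are finite sets here. *)
Lemma degenerate_null : mu N = 0%E.
Proof.
rewrite /mu /product_measure1; apply: integral0_eq => x _ /=.
apply: countable_lebesgue_measure0; apply: finite_set_countable.
apply: sub_finite_set (finite_degenerate P_gt0 x) => y.
by rewrite xsectionE.
Qed.

Lemma measurable_tau : measurable_fun setT (fun x : T * T => tau s (chart x)).
Proof.
have mc p : measurable_fun setT (fun x : T * T => cheby p (chart x)).
  have mb c : measurable_fun setT (fun x : T * T => bary c x * p 0 c).
    by apply: measurable_funM => //; exact: measurable_bary.
  rewrite /cheby; elim: (index_enum _) => [|c cs IH].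
    by under eq_fun do rewrite big_nil; exact: mb.
  by under eq_fun do rewrite big_cons; apply: measurable_maxr; [exact: mb|exact: IH].
rewrite /tau; elim: {2}s => [|p ps IH]; first by under eq_fun do rewrite big_nil; exact: mc.
by under eq_fun do rewrite big_cons; apply: measurable_minr; [exact: mc|exact: IH].
Qed.

Let ts := [seq t <- triples n | emits P n t].

Definition piece (t : 'I_3 * nat * nat) (x : T * T) : R :=
  let: (i, m, l) := t in
  P m i * quad_fun i (slab P n i m l) (slab P n i m l.+1) (base_height P n i m l)
            (vbreak P i m m) x.

Lemma piece_ge0 t x : t \in ts -> 0 <= piece t x.
Proof.
case: t => [[i m] l]; rewrite mem_filter mem_triples => /and3P[em mn ln].
have [? ? ? ?] := emits_quad P_gt0 mn em.
by rewrite /piece mulr_ge0 ?quad_fun_ge0// ltW// P_gt0.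
Qed.

Lemma measurable_piece t : measurable_fun setT (piece t).
Proof.
by case: t => [[i m] l]; apply: measurable_funM => //; exact: measurable_quad_fun.
Qed.

Lemma integral_piece t : t \in ts -> (\int[mu]_x (piece t x)%:E = (cell_val P n t)%:E)%E.
Proof.
case: t => [[i m] l]; rewrite mem_filter mem_triples => /and3P[em mn ln].
have [? ? ? ?] := emits_quad P_gt0 mn em.
rewrite /piece; under eq_integral do rewrite EFinM.
rewrite ge0_integralZl_EFin//; last 3 first.
- by move=> x _; rewrite lee_fin quad_fun_ge0.
- by apply/measurable_EFinP; exact: measurable_quad_fun.
- by rewrite ltW// P_gt0.
rewrite integral_quad_fun// -EFinM; congr (_%:E).
by rewrite /cell_val /quad_val /corner; ring.
Qed.

Lemma piece_outside t x : t \in ts -> ~ in_cell P n t x -> piece t x = 0.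
Proof.
case: t => [[i m] l] _ nx; rewrite /piece /quad_fun.
case: ifP => [/and4P[h1 h2 h3 h4]|]; last by rewrite mulr0.
by case: nx; split=> //; exact: ltW.
Qed.

Lemma piece_inside t x : t \in ts -> in_cell P n t x -> ~ degenerate P n x ->
  piece t x = tau s (chart x).
Proof.
case: t => [[i m] l]; rewrite mem_filter mem_triples => /and3P[em mn ln] tx nd.
have [h1 h2] := cell_half_open P_gt0 mn em tx nd.
have act := cell_active P_gt0 mn em tx.
rewrite (tau_active mn act) /piece /quad_fun h1 h2.
by case: tx => -> _ -> _ /=; rewrite mulrC.
Qed.

(** Exactly one summand survives inside the triangle, by covering and uniqueness, and none outside
    it. *)
Lemma sum_pieces x : ~ degenerate P n x ->
  \sum_(t <- ts) piece t x = ((fun x => tau s (chart x)) \_ (@chart R @^-1` @Delta2 R)) x.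
Proof.
move=> nd; have tsu : uniq ts by rewrite filter_uniq// triples_uniq.
rewrite patchE; case: ifPn => [/set_mem /ge0_bary_chart x0|xD].
  have [t /andP[tT et] tx] := cells_cover P_gt0 n0 x0 nd.
  have tts : t \in ts by rewrite mem_filter et.
  rewrite (bigD1_seq t)//= (piece_inside tts tx nd) big_seq_cond big1 ?addr0// => t'.
  move=> /andP[t'ts tt']; apply: piece_outside => // t'x.
  move: (t'ts); rewrite mem_filter => /andP[et' t'T].
  by move/eqP: tt'; apply; exact: (cells_unique P_gt0 t'T et' t'x tT et tx nd).
rewrite big_seq big1// => t tts; apply: piece_outside => // tx.
move: xD; rewrite notin_setE; apply; apply/ge0_bary_chart => c.
exact: in_cell_ge0 tx.
Qed.

Lemma tau_ge0 x : (@chart R @^-1` @Delta2 R) x -> 0 <= tau s (chart x).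
Proof.
move=> /ge0_bary_chart x0.
have c0 p : p \in s -> 0 <= cheby p (chart x).
  move=> ps; apply: le_trans (cheby_ge p (chart x) 0).
  rewrite mulr_ge0 ?x0// -(nth_index 0 ps) ltW// P_gt0//.
  by rewrite index_mem.
rewrite /tau big_seq; apply: (big_ind (fun y => 0 <= y)) => //.
- by apply: c0; have : (0 < size s)%N := n0; case: {+}s => //= p s' _; rewrite mem_head.
- by move=> y z hy hz; rewrite le_min hy.
Qed.

Lemma measurable_Delta2 : measurable (@chart R @^-1` @Delta2 R : set (T * T)).
Proof.
have -> : (@chart R @^-1` @Delta2 R : set (T * T)) =
    \bigcap_(c in [set: 'I_3]) ((fun x : T * T => bary c x) @^-1` `[0, +oo[).
  apply/seteqP; split=> x.
    by move=> /ge0_bary_chart h c _; rewrite /= in_itv /= h.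
  by move=> h; apply/ge0_bary_chart => c; have := h c I; rewrite /= in_itv /= andbT.
apply: fin_bigcap_measurable => // c _.
by rewrite -[X in measurable X]setTI; exact: measurable_bary.
Qed.

Lemma R2_sum : R2 s = (\sum_(t <- ts) cell_val P n t)%:E.
Proof.
(* The guard extends nonnegativity, known for emitted triples only, to all t, as exchanging sum and
   integral requires. *)
have mts t : measurable_fun setT (fun x : T * T => (if t \in ts then piece t x else 0)%:E).
  by apply/measurable_EFinP; case: (t \in ts); [exact: measurable_piece|exact: measurable_cst].
transitivity (\int[mu]_x (\sum_(t <- ts) (if t \in ts then piece t x else 0)%:E))%E; last first.
  rewrite ge0_integral_sum//; last first.
    by move=> t x _; rewrite lee_fin; case: ifPn => [tts|_] //; exact: piece_ge0.
  rewrite -sumEFin; apply: eq_big_seq => t tts.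
  by rewrite tts integral_piece.
rewrite /R2 integral_mkcond; apply: ge0_ae_eq_integral => //.
- apply/(measurable_restrictT _ measurable_Delta2).
  by apply/measurable_EFinP; apply: measurable_funTS; exact: measurable_tau.
- exact: emeasurable_sum.
- by move=> x _; rewrite patchE; case: ifP => // /set_mem xD; rewrite lee_fin tau_ge0.
- move=> x _; apply: sume_ge0 => t _; rewrite lee_fin.
  by case: ifPn => [tts|_] //; exact: piece_ge0.
exists N; split; [exact: measurable_degenerate|exact: degenerate_null|].
move=> x /= h; apply: contrapT => nd; apply: h => _.
have -> : (\sum_(t <- ts) (if t \in ts then piece t x else 0)%:E)%E =
    (\sum_(t <- ts) piece t x)%:E.
  by rewrite -sumEFin; apply: eq_big_seq => t ->.
by rewrite sum_pieces// !patchE; case: ifP.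
Qed.

End R2.
End Integral.

(** * The theorem *)

Section Output.
Variables (R : realType) (s : seq 'rV[rat]_3).
Hypothesis s_gt0 : forall p, p \in s -> forall i : 'I_3, 0 < p 0 i.
Hypothesis s0 : (0 < size s)%N.
Let n := size s.
Let P := coords s.
Let PR m c : R := ratr (P m c).
Let S := [seq rat_vec R p | p <- s].

Lemma coords_rat_vec : (fun m c => (nth 0 S m) 0 c) = PR.
Proof.
apply/funext => m; apply/funext => c; rewrite /PR /P /coords.
have [ms|ms] := ltnP m n; first by rewrite (nth_map 0)// mxE.
(* Past the end both sides are 0. Equality as functions is what permits rewriting inside the
   sweep. *)
by rewrite !nth_default ?size_map// !mxE rmorph0.
Qed.

Lemma ratr_coords_gt0 m c : (m < n)%N -> 0 < PR m c.
Proof. by move=> mn; rewrite ltr0q s_gt0// mem_nth. Qed.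

Lemma main_correct : correct_output R s (run main_prog (input s)).
Proof.
have [V O] := run_main s; split.
  have nS : (0 < size S)%N by rewrite size_map.
  rewrite V add0r (@R2_sum R S nS); last first.
    move=> m c; rewrite size_map => mn.
    by rewrite -[ltRHS]/((fun m c => (nth 0 S m) 0 c) m c) coords_rat_vec ratr_coords_gt0.
  rewrite coords_rat_vec size_map /emitted_val rmorph_sum big_filter; congr (_%:E).
  by apply: eq_big => t; [rewrite ratr_emits|rewrite ratr_cell_val].
exists [seq cell_of s t | t <- triples n & emits P n t]; split.
- by rewrite O -map_comp.
- have -> : [seq cell_polygon R c | c <- [seq cell_of s t | t <- triples n & emits P n t]] =
      [seq cell_quad PR n t | t <- triples n & emits PR n t].
    rewrite -map_comp (eq_filter (ratr_emits R P n)); apply: eq_map => t.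
    by rewrite /PR ratr_cell_quad; case: t => [[i m] l].
  exact: cells_subdivision ratr_coords_gt0 s0.
move=> c /mapP[[[i m] l] + ->]; rewrite mem_filter mem_triples => /and3P[em mn ln].
split; first exact: mem_nth.
move=> x; rewrite /cell_polygon -ratr_cell_quad.
have em' : emits PR n (i, m, l) by rewrite ratr_emits.
rewrite (cell_regionP ratr_coords_gt0); last by rewrite mem_filter em' mem_triples mn.
move=> /(cell_active ratr_coords_gt0 mn em') act.
rewrite (@tau_active R S m i x); rewrite ?size_map ?coords_rat_vec// (nth_map 0)//.
Qed.

End Output.

Theorem theorem7p1 (R : realType) :
  exists (prog : cmd) (C : nat),
    forall s : seq 'rV[rat]_3,
      s != [::] -> uniq s ->
      (forall p, p \in s -> forall i : 'I_3, 0 < p 0 i) ->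
      exists (t : nat) (st : state),
        [/\ exec prog (input s) t st,
            correct_output R s st
          & (t <= C * size s ^ 6)%N].
Proof.
have [C H] := exec_compile wf_main keeps0_main.
exists (compile main_prog), C => s sn _ s_gt0.
have s0 : (0 < size s)%N by rewrite lt0n size_eq0.
have [t [e b]] := H (input s) s0; exists t, (run main_prog (input s)); split=> //.
  exact: main_correct.
by apply: leq_trans b _; rewrite depth_main leq_mul2l leq_pexp2l ?orbT.
Qed.
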